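(* Let $(K,v)$ be a valued field of characteristic $0$ with residue field $\overline{K}$, regarded as an $\mathcal{L}_{Mac,D}$-structure. Suppose that $\mathrm{Th}(K)$ admits quantifier elimination in $\mathcal{L}_{Mac,D}$ and (i) if $\mathrm{char}(\overline{K})=0$ then $(K,v)$ is of prohenselian degree $2$; (ii) if $\mathrm{char}(\overline{K})=p>0$ then $(K,v)$ is of prohenselian degree $1$, $(K,v)$ is tight, and there is a conservative subgroup $\mathcal{C}$ of $K^\times$. Then $v$ is henselian.
   Context: Valuation rings are proper subrings. $\mathcal{L}_{Mac,D}$ consists of $\{+,-,\cdot,0,1\}$, unary predicates $P_n$ ($n>1$) interpreted as the sets of nonzero $n$th powers, and a binary function symbol $D$ interpreted as $D(x,y)=x/y$ if $v(x)\ge v(y)$ and $y\ne0$, and $D(x,y)=0$ otherwise. For a valued field $(L,w)$ with valuation ring $\mathcal{O}$ and maximal ideal $\mathcal{M}$, and $r,t\in\mathcal{O}$: $r\asymp t$ (comparable) if there is a natural number $n\ge1$ with $w(r^n)\le w(t)\le w(r^{n+1})$ or $w(t^n)\le w(r)\le w(t^{n+1})$; $r\ll t$ (also $t\gg r$) if they are incomparable and $w(r)<w(t)$. For $A\subseteq L$, $t\in A$ is a cofinal element of $A$ if $\{nw(t):n\in\mathbb{N}\}$ is cofinal in $\{w(r):r\in A\}$. $\mathbb{Q}(A)$ is the subfield generated by $A$, and $F^L$ is the algebraic closure in $L$ of a subfield $F$. A valuation ring $R$ of a field $F$ admits a henselian coarsening if some henselian valuation ring $R'\subsetneq F$ contains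 $R$. $(L,w)$ is of prohenselian degree $n$ if for each $1\le m\le n$ and all $t_1,\dots,t_m\in\mathcal{M}$ with $t_m\gg\dots\gg t_1$, the valuation ring $\mathbb{Q}(t_1,\dots,t_m)^L\cap\mathcal{O}$ of $\mathbb{Q}(t_1,\dots,t_m)^L$ admits a henselian coarsening. $(K,v)$ is tight if $v(p)$ lies in the smallest nonzero convex subgroup of $vK$. A subgroup $\mathcal{C}$ of $K^\times$ with $\mathbb{Q}^\times\subseteq\mathcal{C}$ is conservative if (1) $p$ is a cofinal element of $\mathbb{Q}(r)^K$ for every $r\in\mathcal{C}$, and (2) $\mathcal{C}$ is an existentially closed substructure of $K^\times$ over $\mathbb{Q}^\times$ (with parameters from $\mathbb{Q}^\times$) in the language of groups. *)

(* Defs.v *)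
From HB Require Import structures.
From mathcomp Require Import all_boot all_order all_algebra.
From mathcomp Require Import classical_sets.

Set Implicit Arguments.
Unset Strict Implicit.
Unset Printing Implicit Defensive.

Import Order.TTheory GRing.Theory Num.Theory.

Local Open Scope classical_set_scope.
Local Open Scope ring_scope.

Record language := Language {
  fsym : Type;
  farity : fsym -> nat;
  rsym : Type;
  rarity : rsym -> nat
}.

(* [term L n] and [formula L n] have their free variables among 'I_n;
   [formula L 0] is the type of sentences. *)
Inductive term (L : language) (n : nat) : Type :=
  | Var of 'I_n
  | App (f : fsym L) of ('I_(farity f) -> term L n).

Inductive formula (L : language) : nat -> Type :=
  | Fbot n : formula L n
  | Feq n of term L n & term L n : formula L n
  | Frel n (r : rsym L) of ('I_(rarity r) -> term L n) : formula L n
  | Fimp n of formula L n & formula L n : formula L n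
  | Fall n of formula L n.+1 : formula L n
  | Fex n of formula L n.+1 : formula L n.

Fixpoint quantifier_free L n (phi : formula L n) : Prop :=
  match phi with
  | Fbot _ | Feq _ _ _ | Frel _ _ _ => True
  | Fimp _ phi psi => quantifier_free phi /\ quantifier_free psi
  | Fall _ _ | Fex _ _ => False
  end.

Fixpoint existential L n (phi : formula L n) : Prop :=
  match phi with
  | Fex _ psi => existential psi
  | phi => quantifier_free phi
  end.

Record structure (L : language) := Structure {
  carrier :> Type;
  fint : forall f : fsym L, ('I_(farity f) -> carrier) -> carrier;
  rint : forall r : rsym L, ('I_(rarity r) -> carrier) -> Prop
}.

Fixpoint eval L (M : structure L) n (e : 'I_n -> M) (t : term L n) : M :=
  match t with
  | Var i => e i
  | App f a => fint (fun i => eval e (a i))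
  end.

(* The quantified variable is [ord0]; the others are shifted by one. *)
Definition extend (T : Type) n (x : T) (e : 'I_n -> T) : 'I_n.+1 -> T :=
  fun i => if unlift ord0 i is Some j then e j else x.

Fixpoint sat L (M : structure L) n (phi : formula L n) : ('I_n -> M) -> Prop :=
  match phi with
  | Fbot _ => fun _ => False
  | Feq _ s t => fun e => eval e s = eval e t
  | Frel _ r a => fun e => rint (fun i => eval e (a i))
  | Fimp _ phi psi => fun e => sat phi e -> sat psi e
  | Fall _ phi => fun e => forall x : M, sat phi (extend x e)
  | Fex _ phi => fun e => exists x : M, sat phi (extend x e)
  end.

Definition theory (L : language) := set (formula L 0).

Definition Th L (M : structure L) : theory L :=
  [set phi | forall e : 'I_0 -> M, sat phi e].

Definition model_of L (T : theory L) (M : structure L) := T `<=` Th M.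

Definition admits_QE L (T : theory L) :=
  forall n (phi : formula L n), exists psi : formula L n,
    quantifier_free psi /\
    forall M : structure L, model_of T M ->
      forall e : 'I_n -> M, sat phi e <-> sat psi e.

Definition substructure_closed L (M : structure L) (A : set M) :=
  forall (f : fsym L) (a : 'I_(farity f) -> M),
    (forall i, A (a i)) -> A (fint a).

Definition substructure L (M : structure L) (A : set M)
    (cA : substructure_closed A) : structure L := {|
  carrier := {x : M | A x};
  fint := fun f a => exist A (fint (fun i => sval (a i)))
                           (cA f (fun i => sval (a i)) (fun i => svalP (a i)));
  rint := fun r a => rint (fun i => sval (a i))
|}.

(* Existential closedness of the substructure A in M, for existential
   formulas whose parameters are taken from P (a subset of A) only. *)
Definition existentially_closed_over L (M : structure L) (A : set M)
    (cA : substructure_closed A) (P : set M) :=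
  forall n (phi : formula L n) (e : 'I_n -> substructure cA),
    existential phi -> (forall i, P (sval (e i))) ->
    sat (M := M) phi (fun i => sval (e i)) -> sat phi e.

Section Subsets.
Variable L : fieldType.
Implicit Types A F R : set L.

Definition subring R := GRing.subring_closed (mem R).
Definition subfield F := GRing.divring_closed (mem F).

Definition Qgen A : set L :=
  [set x | forall F, subfield F -> A `<=` F -> F x].

Definition rel_alg_closure F : set L :=
  [set x | exists p : {poly L},
     [/\ p != 0, p \is a polyOver (mem F) & root p x]].

Definition valuation_ring F R :=
  [/\ subring R, R `<` F &
      forall x, F x -> x != 0 -> R x \/ R x^-1].

(* The set of non-units; 0 is singled out because 0^-1 = 0. *)
Definition nonunits R : set L := [set x | R x /\ (x = 0 \/ ~ R x^-1)].

Definition henselian_valuation_ring F R :=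
  valuation_ring F R /\
  forall (f : {poly L}) (a : L),
    f \is a polyOver (mem R) -> R a ->
    nonunits R f.[a] -> ~ nonunits R f^`().[a] ->
    exists b, [/\ R b, root f b & nonunits R (b - a)].

Definition admits_henselian_coarsening F R :=
  exists R', henselian_valuation_ring F R' /\ R `<=` R'.

End Subsets.

HB.mixin Record POrderedZmodule_isOrderedGroup G of Num.POrderedZmodule G := {
  oag_total : total (<=%R : rel G);
  oag_lerD2l : forall z x y : G, x <= y -> z + x <= z + y
}.

#[short(type="orderedAbelianGroupType")]
HB.structure Definition OrderedAbelianGroup :=
  { G of Num.POrderedZmodule G & POrderedZmodule_isOrderedGroup G }.

(* [option G] is G extended by the value [None] = infinity of 0. *)
Definition leV (G : orderedAbelianGroupType) (a b : option G) : bool :=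
  match a, b with
  | _, None => true
  | None, Some _ => false
  | Some x, Some y => x <= y
  end.

Definition ltV (G : orderedAbelianGroupType) (a b : option G) : bool :=
  ~~ leV b a.

Definition addV (G : orderedAbelianGroupType) (a b : option G) : option G :=
  if a is Some x then if b is Some y then Some (x + y) else None else None.

(* G is the value group, by [val_surj]; by [val_nontriv] the valuation ring
   is a proper subring. *)
Record valuation (L : fieldType) (G : orderedAbelianGroupType) := Valuation {
  val_fun :> L -> option G;
  val_inf : forall x, val_fun x = None <-> x = 0;
  val_mul : forall x y, val_fun (x * y) = addV (val_fun x) (val_fun y);
  val_add : forall x y, leV (val_fun x) (val_fun (x + y))
                     || leV (val_fun y) (val_fun (x + y));
  val_surj : forall g : G, exists x, val_fun x = Some g;
  val_nontriv : exists g : G, g != 0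
}.

Section ValuedField.
Variables (L : fieldType) (G : orderedAbelianGroupType) (w : valuation L G).

Definition val_ring : set L := [set x | leV (Some 0) (w x)].
Definition val_ideal : set L := [set x | ltV (Some 0) (w x)].

(* p%:R = 0 in the residue field val_ring / val_ideal means
   p%:R \in val_ideal. *)
Definition residue_pchar (p : nat) := prime p /\ val_ideal p%:R.
Definition residue_pchar0 := forall p, ~ residue_pchar p.

Definition val_comparable (r t : L) :=
  exists2 n, (1 <= n)%N &
    (leV (w (r ^+ n)) (w t) && leV (w t) (w (r ^+ n.+1))) ||
    (leV (w (t ^+ n)) (w r) && leV (w r) (w (t ^+ n.+1))).

Definition much_less (r t : L) := ~ val_comparable r t /\ ltV (w r) (w t).

(* The condition quantifies over nonzero elements of A only: infinity is not
   an element of the value group. *)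
Definition cofinal_element (A : set L) (t : L) :=
  A t /\ exists2 g, w t = Some g &
    forall r h, A r -> w r = Some h -> exists n : nat, h <= g *+ n.

(* The t i are nonzero: for t i = 0 the ring at hand may be a trivially valued
   field, hence not a valuation ring. *)
Definition prohenselian (n : nat) :=
  forall (m : nat) (t : 'I_m -> L), (1 <= m <= n)%N ->
    (forall i, val_ideal (t i) /\ t i != 0) ->
    (forall i j : 'I_m, j = i.+1 :> nat -> much_less (t i) (t j)) ->
    let F := rel_alg_closure (Qgen (range t)) in
    admits_henselian_coarsening F (F `&` val_ring).

Definition convex_subgroup (H : set G) :=
  GRing.zmod_closed (mem H) /\
  forall x y : G, H x -> 0 <= y -> y <= x -> H y.

Definition nonzero_convex_subgroup (H : set G) :=
  convex_subgroup H /\ exists2 x, H x & x != 0.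

Definition tight (p : nat) :=
  exists H : set G,
    [/\ nonzero_convex_subgroup H,
        forall H', nonzero_convex_subgroup H' -> H `<=` H' &
        exists2 g, w p%:R = Some g & H g].

Definition henselian := henselian_valuation_ring setT val_ring.

End ValuedField.

Inductive mac_fsym := MacZero | MacOne | MacAdd | MacOpp | MacMul | MacD.

Definition mac_farity (f : mac_fsym) : nat :=
  match f with
  | MacZero | MacOne => 0
  | MacOpp => 1
  | MacAdd | MacMul | MacD => 2
  end.

Inductive mac_rsym := MacP (n : nat) of (1 < n)%N.

Definition LMacD : language :=
  Language mac_farity (fun _ : mac_rsym => 1%N).

Section MacStructure.
Variables (L : fieldType) (G : orderedAbelianGroupType) (w : valuation L G).

Definition restricted_div (x y : L) : L :=
  if leV (w y) (w x) && (y != 0) then x / y else 0.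

Definition mac_fint (f : mac_fsym) : ('I_(mac_farity f) -> L) -> L :=
  match f return ('I_(mac_farity f) -> L) -> L with
  | MacZero => fun _ => 0
  | MacOne => fun _ => 1
  | MacAdd => fun a => a ord0 + a ord_max
  | MacOpp => fun a => - a ord0
  | MacMul => fun a => a ord0 * a ord_max
  | MacD => fun a => restricted_div (a ord0) (a ord_max)
  end.

Definition mac_rint (r : mac_rsym) (a : 'I_1 -> L) : Prop :=
  let: MacP n _ := r in a ord0 != 0 /\ exists y, a ord0 = y ^+ n.

Definition mac_structure : structure LMacD :=
  @Structure LMacD L mac_fint mac_rint.

End MacStructure.

Inductive grp_fsym := GrpOne | GrpInv | GrpMul.

Definition grp_farity (f : grp_fsym) : nat :=
  match f with GrpOne => 0 | GrpInv => 1 | GrpMul => 2 end.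

Definition Lgroup : language :=
  Language grp_farity (fun r : void => match r with end).

Section MultiplicativeGroup.
Variable L : fieldType.

Definition nonzero := {x : L | x != 0}.

Definition nz_one : nonzero := exist _ 1 (oner_neq0 L).
Definition nz_inv (x : nonzero) : nonzero :=
  exist _ (sval x)^-1 (invr_neq0 (svalP x)).
Definition nz_mul (x y : nonzero) : nonzero :=
  exist _ (sval x * sval y) (mulf_neq0 (svalP x) (svalP y)).

Definition grp_fint (f : grp_fsym) : ('I_(grp_farity f) -> nonzero) -> nonzero :=
  match f return ('I_(grp_farity f) -> nonzero) -> nonzero with
  | GrpOne => fun _ => nz_one
  | GrpInv => fun a => nz_inv (a ord0)
  | GrpMul => fun a => nz_mul (a ord0) (a ord_max)
  end.

Definition mult_group : structure Lgroup :=
  @Structure Lgroup nonzero grp_fint (fun r => match r with end).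

(* Q^* inside L^*, for L of characteristic 0 *)
Definition rat_units : set mult_group :=
  [set x | exists q : rat, sval x = ratr q].

End MultiplicativeGroup.

(* The substructures of L^* in the language of groups are its subgroups. *)
Definition conservative (L : fieldType) (G : orderedAbelianGroupType)
    (w : valuation L G) (p : nat) (C : set (mult_group L)) :=
  exists cC : substructure_closed C,
    [/\ @rat_units L `<=` C,
        forall r, C r ->
          cofinal_element w (rel_alg_closure (Qgen [set sval r])) p%:R &
        existentially_closed_over cC (@rat_units L)].

(* Main.v *)
Require Import Defs.
From mathcomp Require Import all_boot all_order all_algebra.
From mathcomp Require Import classical_sets boolp filter.
From mathcomp Require Import mpoly.
From mathcomp Require Import ring zify.
Import Order.TTheory GRing.Theory.
Local Open Scope ring_scope.

Set Implicit Arguments.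
Unset Strict Implicit.
Unset Printing Implicit Defensive.

(* Write O for the valuation ring and M for its maximal ideal. Prohenselianity
   of degree 1 (with tightness in mixed characteristic) makes 1 + n^2 x an n-th
   power for all x in M and n > 0, so that the groups of n-th powers are open.

   Consider the condition on (y, z) that every polynomial f over O of degree at
   most n with v(f(0)) >= v(y) and f'(0) a unit takes a value f(x) with x in M
   and v(f(x)) >= v(z). Newton iteration gives it for all powers z of y. By
   quantifier elimination and the openness of the power groups, for suitable y
   it cannot distinguish N!-th powers z of large value, so it holds for all z:
   simple residual roots can be approximated arbitrarily well in K.

   Suppose that some f, monic of least degree n, has a simple residual root and
   no root in M. Then f is irreducible, and the characteristic polynomials of
   elements of K[X]/(f) close to X have no root either; they are Zariski dense
   in the space of monic polynomials of degree n. A quantifier-free formula is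
   locally constant off a proper Zariski closed set, so some polynomial g of
   this kind has a neighbourhood of polynomials without roots in M. But
   g - g(x) has the root x and is as close to g as we like. *)

(** * Valuations *)

(** Two obstacles shape the argument: the powers of y reached by Newton iteration need not be
    cofinal in the value group, and approximate roots need not converge in K. Quantifier elimination
    is used once against each. Against the first, a quantifier-free formula in y and z becomes a
    finite list of conditions on polynomials in z over a ring [R0] containing y. Its nonzero
    elements must all divide powers of y; then the lowest term of each polynomial dominates once z
    is small enough. In residue characteristic 0 this ring is Z[y] with y = f(0). In residue
    characteristic p it is Z with y = p, and tightness lets Newton iteration bring v(f(x)) up to
    v(p). An N!-th power z is an m-th power for all m <= N, so that the predicates P_m only see
    coefficients from [R0]. The constant n^2 comes from (1 + n y)^n = 1 + n^2 (y + y^2 q(y)):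
    whatever the value of n, the polynomial in brackets has linear coefficient 1. Both uses impose
    conditions with thresholds that depend on the formula; an ultrafilter collects them and settles
    the case distinction in D. *)

Lemma polyOver_mem (K : fieldType) (A : set K) (f : {poly K}) : A 0 ->
  f \is a polyOver (mem A) <-> forall i, A f`_i.
Proof.
move=> A0; rewrite qualifE /=; split=> [/(all_nthP 0) h i|h].
  have [/h|/(nth_default 0)->//] := ltnP i (size f).
  by move/set_mem.
by apply/(all_nthP 0) => i _; apply/mem_set.
Qed.

Section Valuation.
Variables (K : fieldType) (G : orderedAbelianGroupType) (v : valuation K G).
Implicit Types (a b c x y z : K) (f g : {poly K}).

(** Divisibility in O: b lies in a O. Small elements are high in this order, with 0 on top.
    Estimates stated in K keep infinity and the group [G] out of the computations. *)
Definition val_le a b := leV (v a) (v b).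
Definition val_integral x : Prop := val_le 1 x.
Definition val_small x : Prop := ~~ val_le x 1.
Local Notation vle := val_le.
Local Notation vint := val_integral.
Local Notation vmax := val_small.

Lemma leV_refl (s : option G) : leV s s.
Proof. by case: s => //= s; case/orP: (oag_total s s). Qed.

Lemma leV_trans (s t u : option G) : leV s t -> leV t u -> leV s u.
Proof. by case: s t u => [s|] [t|] [u|] //=; exact: le_trans. Qed.

Lemma vle_refl a : vle a a. Proof. exact: leV_refl. Qed.

Lemma vle_trans b a c : vle a b -> vle b c -> vle a c.
Proof. exact: leV_trans. Qed.

Lemma vle_total a b : vle a b || vle b a.
Proof.
rewrite /vle; case: (v a) (v b) => [s|] [t|] //=; exact: oag_total.
Qed.

Lemma val_zero : v 0 = None. Proof. by apply/val_inf. Qed.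

Lemma vle0 a : vle a 0.
Proof. by rewrite /vle val_zero; case: (v a). Qed.

Lemma vle_0 a : vle 0 a -> a = 0.
Proof.
by rewrite /vle val_zero; case e: (v a) => [s|] //= _; apply/(val_inf v).
Qed.

Lemma vleM c a b : vle a b -> vle (c * a) (c * b).
Proof.
rewrite /vle !val_mul; case: (v a) (v b) (v c) => [s|] [t|] [u|] //=.
exact: oag_lerD2l.
Qed.

Lemma vleM2 a b c d : vle a b -> vle c d -> vle (a * c) (b * d).
Proof.
by move=> ab cd; apply: (@vle_trans (a * d)); [|rewrite ![_ * d]mulrC]; apply: vleM.
Qed.

Lemma vleMl c a b : c != 0 -> vle (c * a) (c * b) = vle a b.
Proof.
move=> c0; apply/idP/idP; last exact: vleM.
by move/(vleM c^-1); rewrite !mulKf.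
Qed.

Lemma vleMr c a b : c != 0 -> vle (a * c) (b * c) = vle a b.
Proof. by rewrite ![_ * c]mulrC; exact: vleMl. Qed.

Lemma vle_add c a b : vle c a -> vle c b -> vle c (a + b).
Proof.
move=> ca cb; case/orP: (val_add v a b) => h; [exact: leV_trans ca h|].
exact: leV_trans cb h.
Qed.

Lemma val_one : v 1 = Some 0.
Proof.
case e: (v 1) => [s|]; last by have /val_inf/eqP := e; rewrite oner_eq0.
have := val_mul v 1 1; rewrite mulr1 e /= => -[] /eqP.
by rewrite -subr_eq0 opprD addNKr oppr_eq0 => /eqP ->.
Qed.

Lemma vle_N1 : vle 1 (-1).
Proof.
case/orP: (vle_total 1 (-1)) => // /(vleM (-1)).
by rewrite mulrNN !mulr1.
Qed.

Lemma vleN a b : vle a (- b) = vle a b.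
Proof.
have h c d : vle c d -> vle c (- d).
  by move=> cd; rewrite -[c]mul1r -mulN1r; apply: vleM2 => //; exact: vle_N1.
by apply/idP/idP => /h //; rewrite opprK.
Qed.

Lemma vleNl a b : vle (- a) b = vle a b.
Proof. by rewrite -[in LHS]mulN1r -[RHS](@vleMl (-1)) ?oppr_eq0 ?oner_eq0 // !mulN1r vleN. Qed.

Lemma vle_sub c a b : vle c a -> vle c b -> vle c (a - b).
Proof. by move=> ca cb; apply: vle_add; rewrite ?vleN. Qed.

Lemma vleV a b : a != 0 -> b != 0 -> vle a^-1 b^-1 = vle b a.
Proof.
move=> a0 b0; rewrite -(@vleMl (a * b)) ?mulf_neq0 //.
by rewrite mulrAC divff // mul1r mulfK.
Qed.

Lemma vle_neq0 a b : vle a b -> b != 0 -> a != 0.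
Proof. by move=> ab; apply: contraNneq => a0; rewrite a0 in ab; rewrite (vle_0 ab). Qed.

Lemma vleX a b n : vle a b -> vle (a ^+ n) (b ^+ n).
Proof.
by move=> ab; elim: n => [|n IH]; rewrite ?expr0 ?vle_refl // !exprS vleM2.
Qed.

Lemma vint_ring x : vint x <-> val_ring v x.
Proof. by rewrite /vint /vle val_one. Qed.

Lemma vmax_ideal x : vmax x <-> val_ideal v x.
Proof. by rewrite /vmax /vle val_one. Qed.

Lemma vint1 : vint 1. Proof. exact: vle_refl. Qed.
Lemma vint0 : vint 0. Proof. exact: vle0. Qed.
Lemma vintD a b : vint a -> vint b -> vint (a + b). Proof. exact: vle_add. Qed.
Lemma vintB a b : vint a -> vint b -> vint (a - b). Proof. exact: vle_sub. Qed.
Lemma vintN a : vint a -> vint (- a). Proof. by rewrite /vint vleN. Qed.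
Lemma vintM a b : vint a -> vint b -> vint (a * b).
Proof. by move=> ha hb; rewrite /vint -[1]mulr1 vleM2. Qed.
Lemma vintX a n : vint a -> vint (a ^+ n).
Proof. by move=> ha; rewrite /vint -(expr1n K n) vleX. Qed.
Lemma vint_nat n : vint n%:R.
Proof. by elim: n => [|n IH]; [exact: vint0|rewrite -natr1; apply: vintD => //; exact: vint1]. Qed.
Lemma vint_int (m : int) : vint m%:~R.
Proof.
by case: m => n; [|rewrite NegzE mulrNz; apply: vintN]; rewrite -pmulrn; exact: vint_nat.
Qed.

Lemma vmax_vint x : vmax x -> vint x.
Proof. by move/negPf => h; case/orP: (vle_total 1 x) => //; rewrite h. Qed.

Lemma vmax0 : vmax 0.
Proof. by rewrite /vmax; apply/negP => /vle_0/eqP; rewrite oner_eq0. Qed.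

Lemma vmax1 : ~ vmax 1. Proof. by rewrite /vmax vle_refl. Qed.

Lemma vmaxN x : vmax x -> vmax (- x). Proof. by rewrite /vmax vleNl. Qed.

Lemma vmaxMl a x : vint a -> vmax x -> vmax (a * x).
Proof.
move=> ha; apply: contra => h; apply: vle_trans h.
by rewrite -[X in vle X _]mul1r vleM2 // vle_refl.
Qed.

Lemma vmaxMr a x : vint a -> vmax x -> vmax (x * a).
Proof. by rewrite mulrC; exact: vmaxMl. Qed.

Lemma vmax_vle a b : vle a b -> vmax a -> vmax b.
Proof. by move=> ab; apply: contra; exact: vle_trans. Qed.

Lemma vmaxD a b : vmax a -> vmax b -> vmax (a + b).
Proof.
wlog ab : a b / vle a b.
  by move=> H ha hb; case/orP: (vle_total a b) => h; [|rewrite addrC]; apply: H.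
move=> ha hb; apply: vmax_vle ha; apply: vle_add => //; exact: vle_refl.
Qed.

Lemma vmaxB a b : vmax a -> vmax b -> vmax (a - b).
Proof. by move=> ha hb; apply: vmaxD => //; exact: vmaxN. Qed.

Lemma vmax_inv x : x != 0 -> vmax x <-> ~ vint x^-1.
Proof.
move=> x0; rewrite /vmax /vint -(@vleMl x 1 x^-1) // mulr1 divff //.
by split => [/negP|/negP].
Qed.

Definition val_unit x : Prop := vint x /\ ~ vmax x.
Local Notation vunit := val_unit.

Lemma vunitP x : vunit x <-> vle 1 x && vle x 1.
Proof.
rewrite /vunit /vint /vmax; split => [[-> h]|/andP[-> ->]] //=.
by apply/negPn/negP.
Qed.

Lemma vunit_neq0 x : vunit x -> x != 0.
Proof. by case=> _ h; apply: contra_notN h => /eqP ->; exact: vmax0. Qed.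

Lemma vunitM a b : vunit a -> vunit b -> vunit (a * b).
Proof.
move=> /vunitP/andP[a1 a2] /vunitP/andP[b1 b2]; apply/vunitP.
by rewrite -[1]mulr1 !vleM2.
Qed.

Lemma vunitMl a b : vint a -> vint b -> vunit (a * b) -> vunit a.
Proof. by move=> ha hb [_ h]; split => // m; apply: h; exact: vmaxMr. Qed.

Lemma vunitV a : vunit a -> vunit a^-1.
Proof.
move=> h; have a0 := vunit_neq0 h; move/vunitP/andP: h => [h1 h2].
by apply/vunitP; rewrite -[1]invr1 !vleV ?oner_eq0 // h1 h2.
Qed.

Lemma vunitX a n : vunit a -> vunit (a ^+ n).
Proof.
move=> h; elim: n => [|n IH]; rewrite ?exprS; last exact: vunitM.
by apply/vunitP; rewrite !vle_refl.
Qed.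

Lemma vunitD a x : vunit a -> vmax x -> vunit (a + x).
Proof.
move=> [h1 h2] hx; split; first by apply: vintD => //; exact: vmax_vint.
by move=> h; apply: h2; rewrite -[a](addrK x); exact: vmaxB.
Qed.

Lemma vunit1D x : vmax x -> vunit (1 + x).
Proof. by apply: vunitD; split; [exact: vint1|exact: vmax1]. Qed.

Lemma vunitN a : vunit a -> vunit (- a).
Proof. by move=> [h1 h2]; split; [exact: vintN|move/vmaxN; rewrite opprK]. Qed.

Lemma vmax_prime a b : vint a -> vint b -> vmax (a * b) -> vmax a \/ vmax b.
Proof.
move=> ha hb h; apply: contrapT => /not_orP[h1 h2].
by case: (vunitM (conj ha h1) (conj hb h2)).
Qed.

Lemma vmaxX x n : vmax x -> vmax (x ^+ n.+1).
Proof. by move=> h; rewrite exprS; apply: vmaxMr => //; apply: vintX; exact: vmax_vint. Qed.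

Lemma vint_div a b : b != 0 -> vint (a / b) <-> vle b a.
Proof. by move=> b0; rewrite /vint -(@vleMr b) // mul1r divfK. Qed.

Lemma vleMint a b c : vint c -> vle a b -> vle a (b * c).
Proof. by move=> hc ab; rewrite -[a]mulr1 vleM2. Qed.

Lemma vle_unitM a b : vunit b -> vle (a * b) =1 vle a.
Proof.
move=> hb c; have b0 := vunit_neq0 hb; move/vunitP/andP: hb => [h1 h2].
apply/idP/idP => h; last first.
  apply: vle_trans h; rewrite -[X in vle _ X]mulr1; exact: vleM.
by apply: vle_trans h; rewrite -[X in vle X _]mulr1; exact: vleM.
Qed.

Lemma vle_unitMr a b c : vunit b -> vle c (a * b) = vle c a.
Proof.
move=> hb; have b0 := vunit_neq0 hb.
by rewrite -(@vle_unitM (c) (b)) // vleMr.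
Qed.

Lemma vle_expl x m n : vint x -> (m <= n)%N -> vle (x ^+ m) (x ^+ n).
Proof.
by move=> hx /subnKC <-; rewrite exprD; apply: vleMint; [exact: vintX|exact: vle_refl].
Qed.

Definition vpoly f := forall i, vint f`_i.

Lemma vpolyOver f : f \is a polyOver (mem (val_ring v)) <-> vpoly f.
Proof.
rewrite polyOver_mem; last by apply/vint_ring; exact: vint0.
by split=> h i; apply/vint_ring.
Qed.

Lemma vpoly_ind (P : {poly K} -> Prop) :
  P 0 -> (forall f c, vpoly f -> vint c -> P f -> P (f * 'X + c%:P)) ->
  forall f, vpoly f -> P f.
Proof.
move=> P0 PS f; elim/poly_ind: f => // f c IH h.
have hc : vint c by have := h 0%N; rewrite coefD coefMX coefC /= add0r.
have hf : vpoly f.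
  by move=> i; have := h i.+1; rewrite coefD coefMX coefC /= addr0.
exact: PS (IH hf).
Qed.

Lemma vpoly_horner f x : vpoly f -> vint x -> vint f.[x].
Proof.
move=> hf hx; elim/vpoly_ind: f / hf => [|f c hf hc IH]; first by rewrite horner0; exact: vint0.
by rewrite !hornerE; apply: vintD => //; exact: vintM.
Qed.

Lemma vpoly_deriv f : vpoly f -> vpoly f^`().
Proof.
move=> hf i; rewrite coef_deriv -mulr_natr; apply: vintM => //; exact: vint_nat.
Qed.

Lemma vpolyD f g : vpoly f -> vpoly g -> vpoly (f + g).
Proof. by move=> hf hg i; rewrite coefD; exact: vintD. Qed.

Lemma vpolyC c : vint c -> vpoly c%:P.
Proof. by move=> hc i; rewrite coefC; case: ifP => // _; exact: vint0. Qed.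

Lemma vpolyM f g : vpoly f -> vpoly g -> vpoly (f * g).
Proof.
move=> hf hg i; rewrite coefM; elim/big_ind: _ => [||j _]; [exact: vint0|exact: vintD|exact: vintM].
Qed.

Lemma vpolyX : vpoly 'X.
Proof. by move=> i; rewrite coefX; case: eqP => _; [exact: vint1|exact: vint0]. Qed.

Lemma vpoly_comp f g : vpoly f -> vpoly g -> vpoly (f \Po g).
Proof.
move=> hf hg; elim/vpoly_ind: f / hf => [|f c hf hc IH]; first by rewrite comp_poly0; exact: vpolyC vint0.
rewrite comp_polyD comp_polyM comp_polyX comp_polyC; apply: vpolyD; [exact: vpolyM|exact: vpolyC].
Qed.

Lemma taylor1 f x e : vpoly f -> vint x -> vint e ->
  exists2 q, vint q & f.[x + e] = f.[x] + q * e.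
Proof.
move=> hf hx he; elim/vpoly_ind: f / hf => [|f c hf hc [q hq E]].
  by exists 0; [exact: vint0|rewrite !horner0 mul0r addr0].
exists (q * (x + e) + f.[x]).
  by apply: vintD; [apply: vintM => //; exact: vintD|exact: vpoly_horner].
rewrite !hornerE E; ring.
Qed.

Lemma taylor2 f x e : vpoly f -> vint x -> vint e ->
  exists2 q, vint q & f.[x + e] = f.[x] + f^`().[x] * e + q * e ^+ 2.
Proof.
move=> hf hx he; elim/vpoly_ind: f / hf => [|f c hf hc [q hq E]].
  by exists 0; [exact: vint0|rewrite deriv0 !horner0 !mul0r !addr0].
exists (q * (x + e) + f^`().[x]).
  by apply: vintD; [apply: vintM => //; exact: vintD|apply: vpoly_horner => //; exact: vpoly_deriv].
rewrite derivD derivM derivX derivC addr0 mulr1 !(hornerD, hornerM, hornerX, hornerC) E; ring.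
Qed.

Lemma vunit_horner f x : vpoly f -> vmax x -> vunit f.[0] -> vunit f.[x].
Proof.
move=> hf hx h; have [q hq E] := taylor1 hf vint0 (vmax_vint hx).
by rewrite add0r in E; rewrite E; apply: vunitD => //; exact: vmaxMl.
Qed.

(** The derivative stays a unit because x stays in M, and a Newton step turns an error divisible by
    y^(k+1) into one divisible by y^(2k+2); one more factor y is all that is kept. *)
Lemma newton f y k : vpoly f -> vunit f^`().[0] -> vmax y -> vle y f.[0] ->
  exists2 x, vmax x & vle (y ^+ k.+1) f.[x].
Proof.
move=> hf hf' hy h0; elim: k => [|k [x hx IH]].
  by exists 0; [exact: vmax0|rewrite expr1].
have hu : vunit f^`().[x] by apply: vunit_horner => //; exact: vpoly_deriv.
have iu := vunitV hu.
have u0 := vunit_neq0 hu.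
pose e := - (f.[x] / f^`().[x]).
have he : vle (y ^+ k.+1) e by rewrite /e vleN; apply: vleMint => //; case: iu.
have hem : vmax e by apply: (vmax_vle he); exact: vmaxX.
have [q hq E] := taylor2 hf (vmax_vint hx) (vmax_vint hem).
exists (x + e); first exact: vmaxD.
rewrite E {1}/e mulrN mulrCA divff // mulr1 subrr add0r mulrC.
apply: vleMint => //; apply: (@vle_trans ((y ^+ k.+1) ^+ 2)); last exact: vleX.
rewrite -exprM; apply: vle_expl; first exact: vmax_vint.
lia.
Qed.

End Valuation.

(** * Powers close to 1 *)

Definition hornerz (K : fieldType) (x : K) (h : {poly int}) : K :=
  (map_poly intr h).[x].

Section Subrings.
Variable K : fieldType.
Implicit Types (A F : set K) (t x y : K).

Lemma subringP A : subring A ->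
  [/\ A 1, forall x y, A x -> A y -> A (x - y) & forall x y, A x -> A y -> A (x * y)].
Proof.
case=> h1 hB hM; split; first exact/set_mem.
  by move=> x y hx hy; apply/set_mem; apply: hB; exact/mem_set.
by move=> x y hx hy; apply/set_mem; apply: hM; exact/mem_set.
Qed.

Lemma subfieldP A : subfield A <->
  [/\ A 1, forall x y, A x -> A y -> A (x - y) & forall x y, A x -> A y -> A (x / y)].
Proof.
split=> -[h1 hB hM]; split.
- exact/set_mem.
- by move=> x y hx hy; apply/set_mem; apply: hB; exact/mem_set.
- by move=> x y hx hy; apply/set_mem; apply: hM; exact/mem_set.
- exact/mem_set.
- by move=> x y /set_mem hx /set_mem hy; apply/mem_set; apply: hB.
- by move=> x y /set_mem hx /set_mem hy; apply/mem_set; apply: hM.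
Qed.

Lemma subring0 A : subring A -> A 0.
Proof. by case/subringP=> h1 hB _; rewrite -(subrr 1); exact: hB. Qed.

Lemma subringN A x : subring A -> A x -> A (- x).
Proof.
by move=> hA hx; rewrite -sub0r; case/subringP: (hA) => _ hB _; apply: hB => //; exact: subring0.
Qed.

Lemma subringD A x y : subring A -> A x -> A y -> A (x + y).
Proof.
move=> hA hx hy; rewrite -[y]opprK; case/subringP: (hA) => _ hB _; apply: hB => //.
exact: subringN.
Qed.

Lemma subringX A x n : subring A -> A x -> A (x ^+ n).
Proof.
move=> hA hx; case/subringP: hA => h1 _ hM.
by elim: n => [|n IH]; rewrite ?expr0 // exprS; exact: hM.
Qed.

Lemma subring_nat A n : subring A -> A n%:R.
Proof.
move=> hA; elim: n => [|n IH]; first exact: subring0.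
by rewrite -natr1; apply: subringD => //; case/subringP: hA.
Qed.

Lemma subring_int A (m : int) : subring A -> A m%:~R.
Proof.
move=> hA; case: m => n; rewrite ?NegzE ?mulrNz -pmulrn; last apply: subringN => //.
  exact: subring_nat.
exact: subring_nat.
Qed.

Lemma subring_sum A (I : Type) (r : seq I) (P : pred I) (E : I -> K) :
  subring A -> (forall i, P i -> A (E i)) -> A (\sum_(i <- r | P i) E i).
Proof.
move=> hA h; elim/big_ind: _ => //; [exact: subring0|].
by move=> x y; exact: subringD.
Qed.

Lemma subring_hornerz A x h : subring A -> A x -> A (hornerz x h).
Proof.
move=> hA hx; rewrite /hornerz horner_coef; apply: subring_sum => // i _.
case/subringP: (hA) => _ _; apply; first by rewrite coef_map /=; exact: subring_int.
exact: subringX.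
Qed.

Lemma subfield_subring F : subfield F -> subring F.
Proof.
move=> /subfieldP[h1 hB hD]; split; first exact/mem_set.
  by move=> x y /set_mem hx /set_mem hy; apply/mem_set; apply: hB.
move=> x y /set_mem hx /set_mem hy; apply/mem_set.
by rewrite -[y]invrK; apply: (hD) => //; rewrite -[y^-1]mul1r; exact: hD.
Qed.

Lemma Qgen_subfield A : subfield (Qgen A).
Proof.
apply/subfieldP; split=> [F|x y hx hy F|x y hx hy F] hF AF; case/subfieldP: (hF) => h1 hB hD.
- by [].
- by apply: hB; [exact: hx|exact: hy].
- by apply: hD; [exact: hx|exact: hy].
Qed.

Lemma Qgen_sub A x : A x -> Qgen A x.
Proof. by move=> Ax F _; apply. Qed.

Lemma sub_rel_alg_closure F x : subfield F -> F x -> rel_alg_closure F x.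
Proof.
move=> hF Fx; have hR := subfield_subring hF.
exists ('X - x%:P); split; first by rewrite polyXsubC_eq0.
  rewrite polyOver_mem; last exact: subring0.
  move=> i; rewrite coefB coefX coefC.
  case: (subringP hR) => h1 hB _; apply: hB; [case: eqP => _ //; exact: subring0|].
  by case: eqP => _ //; exact: subring0.
by rewrite root_XsubC.
Qed.

Lemma hornerzD x h g : hornerz x (h + g) = hornerz x h + hornerz x g.
Proof. by rewrite /hornerz rmorphD hornerD. Qed.
Lemma hornerzM x h g : hornerz x (h * g) = hornerz x h * hornerz x g.
Proof. by rewrite /hornerz rmorphM hornerM. Qed.
Lemma hornerzN x h : hornerz x (- h) = - hornerz x h.
Proof. by rewrite /hornerz rmorphN hornerN. Qed.
Lemma hornerzC x (m : int) : hornerz x m%:P = m%:~R.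
Proof. by rewrite /hornerz map_polyC hornerC. Qed.
Lemma hornerzX x : hornerz x 'X = x.
Proof. by rewrite /hornerz map_polyX hornerX. Qed.

Lemma Qgen1P t x : Qgen [set t] x ->
  exists h g, hornerz t g != 0 /\ x = hornerz t h / hornerz t g.
Proof.
move=> /(_ [set x | exists h g, hornerz t g != 0 /\ x = hornerz t h / hornerz t g]%classic).
apply; last first.
  by move=> _ ->; exists 'X, 1%:P; rewrite hornerzX hornerzC mulr1z divr1 oner_neq0.
apply/subfieldP; split.
- by exists 1%:P, 1%:P; rewrite !hornerzC mulr1z divr1 oner_neq0.
- move=> _ _ [h1 [g1 [n1 ->]]] [h2 [g2 [n2 ->]]].
  exists (h1 * g2 - h2 * g1), (g1 * g2).
  rewrite hornerzM mulf_neq0 // hornerzD hornerzN !hornerzM; split=> //.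
  by field; rewrite n1 n2.
- move=> _ _ [h1 [g1 [n1 ->]]] [h2 [g2 [n2 ->]]].
  have [e|n3] := eqVneq (hornerz t h2) 0.
    exists 0%:P, 1%:P; rewrite !hornerzC mulr1z oner_neq0; split=> //.
    by rewrite e mul0r invr0 mulr0 mul0r.
  exists (h1 * g2), (g1 * h2); rewrite !hornerzM mulf_neq0 //; split=> //.
  by field; rewrite n1 n2 n3.
Qed.

Lemma Qgen1_hornerz t h : Qgen [set t] (hornerz t h).
Proof.
apply: (@subring_hornerz (Qgen [set t])); first exact: subfield_subring (Qgen_subfield _).
exact: Qgen_sub.
Qed.

(** The reciprocal polynomial X^d p(1/X), d = deg p, which annihilates the inverses of the nonzero
    roots of p. *)
Definition rev_poly (p : {poly K}) : {poly K} :=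
  \poly_(i < size p) p`_((size p).-1 - i).

Lemma horner_rev p x : x != 0 -> (rev_poly p).[x^-1] * x ^+ (size p).-1 = p.[x].
Proof.
move=> x0; rewrite horner_poly mulr_suml horner_coef.
case: (size p) => [|n]; first by rewrite !big_ord0.
rewrite (reindex_inj rev_ord_inj) /=; apply: eq_bigr => i _.
rewrite subSS subKn; last by case: i => i /=; lia.
rewrite -mulrA; congr (_ * _); rewrite exprVn.
have -> : x ^+ n = x ^+ (n - i) * x ^+ i by rewrite -exprD subnK //; case: i => i /=; lia.
by rewrite mulKf // expf_neq0.
Qed.

Lemma rev_poly_neq0 p : p != 0 -> rev_poly p != 0.
Proof.
move=> p0; apply/eqP => e.
have : (rev_poly p)`_0 = 0 by rewrite e coef0.
rewrite coef_poly size_poly_gt0 p0 subn0 -lead_coefE => /eqP.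
by rewrite lead_coef_eq0 (negPf p0).
Qed.

Lemma rel_alg_closureV F x : F 0 -> rel_alg_closure F x -> rel_alg_closure F x^-1.
Proof.
move=> F0 [p [p0 hp rp]].
have [x0|x0] := eqVneq x 0; first by rewrite x0 invr0 -x0; exists p.
exists (rev_poly p); split; first exact: rev_poly_neq0.
  move/(polyOver_mem _ F0): hp => hp; apply/(polyOver_mem _ F0) => i.
  by rewrite coef_poly; case: ifP.
apply/rootP; apply: (mulIf (expf_neq0 (size p).-1 x0)).
by rewrite horner_rev // mul0r; apply/rootP.
Qed.

End Subrings.

Lemma intr_eq0_char0 (K : fieldType) : [pchar K] =i pred0 ->
  forall m : int, (m%:~R == 0 :> K) = (m == 0).
Proof.
by move=> /pcharf0P h [m|m]; rewrite ?NegzE ?mulrNz ?oppr_eq0 -pmulrn h.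
Qed.

(** Isolates the lowest term of h, the one that governs the value of h at small arguments. *)
Lemma poly_factorX (R : idomainType) (h : {poly R}) : h != 0 ->
  exists i m g, m != 0 /\ h = 'X^i * (m%:P + 'X * g).
Proof.
elim/poly_ind: h => [|h c IH]; first by rewrite eqxx.
have [-> | c0] := eqVneq c 0; last first.
  by move=> _; exists 0%N, c, h; split=> //; rewrite expr0 mul1r addrC mulrC.
rewrite addr0 mulf_eq0 polyX_eq0 orbF => /IH[i [m [g [m0 ->]]]].
by exists i.+1, m, g; split=> //; rewrite exprSr -!mulrA; congr (_ * _); rewrite mulrC.
Qed.

Lemma deriv_neq0 (R : idomainType) (p : {poly R}) :
  [pchar R] =i pred0 -> (1 < size p)%N -> p^`() != 0.
Proof.
move=> /pcharf0P ch sp; apply/eqP => /polyP/(_ (size p).-2)/eqP.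
have e : (size p).-2.+1 = (size p).-1 by case: (size p) sp => [|[]].
rewrite coef_deriv coef0 e -lead_coefE -mulr_natr mulf_eq0 lead_coef_eq0 ch -size_poly_eq0.
by case: (size p) sp => [|[]].
Qed.

(** * Henselian coarsenings on the fields Q(t)^K *)

Section Coarsening.
Variables (K : fieldType) (G : orderedAbelianGroupType) (v : valuation K G).
Hypothesis char0 : [pchar K] =i pred0.
Implicit Types (t x y a b : K).

Local Notation vmax := (val_small v).
Local Notation vint := (val_integral v).
Local Notation vunit := (val_unit v).
Local Notation vle := (val_le v).

(** The linear term n (n y) and all powers (n y)^k with k >= 2 carry the factor n^2. Once it is
    removed, the coefficient of y is 1, so Hensel's lemma applies even if n lies in M. *)
Lemma expr_1D n : exists q : {poly int}, forall y : K,
  (1 + n%:R * y) ^+ n = 1 + n%:R ^+ 2 * (y + y ^+ 2 * hornerz y q).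
Proof.
suff [q Eq] : exists q : {poly int}, forall y : K,
    (1 + n%:R * y) ^+ n = 1 + n%:R * n%:R * y + n%:R ^+ 2 * (y ^+ 2 * hornerz y q).
  by exists q => y; rewrite Eq expr2; ring.
(* Only the exponent varies: (1 + n y)^m = 1 + m n y + n^2 y^2 q_m(y), with n fixed. *)
elim: {2 3}n => [|m [q IH]].
  by exists 0%:P => y; rewrite expr0 hornerzC mulr0z; ring.
exists (m%:Z%:P + q + n%:Z%:P * 'X * q) => y.
rewrite exprS IH !hornerzD !hornerzM hornerzX !hornerzC -!pmulrn -natr1; ring.
Qed.

Section Ring.
Variables (t : K) (R : set K).
Local Notation F := (rel_alg_closure (Qgen [set t])).
Hypothesis hR : henselian_valuation_ring F R.
Hypothesis hO : (F `&` val_ring v `<=` R)%classic.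

Let Rring : subring R. Proof. by case: hR => -[]. Qed.
Let RF x : R x -> F x. Proof. by case: hR => -[_ [h _] _] _; exact: h. Qed.
Let RM x y : R x -> R y -> R (x * y). Proof. by case/subringP: Rring => _ _; apply. Qed.
Let RB x y : R x -> R y -> R (x - y). Proof. by case/subringP: Rring => _ h _; exact: h. Qed.
Let R1 : R 1. Proof. by case/subringP: Rring. Qed.

Lemma coarse_vint x : F x -> vint x -> R x.
Proof. by move=> Fx /vint_ring vx; apply: hO. Qed.

(** A larger valuation ring has a smaller maximal ideal: for x outside M, the inverse of x lies in F
    and in O, hence in R. *)
Lemma coarse_vmax x : nonunits R x -> vmax x.
Proof.
move=> [Rx [->|nV]]; first exact: vmax0.
apply: contrapT => h; apply: nV.
have x0 : x != 0 by apply: contra_notN h => /eqP ->; exact: vmax0.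
apply: coarse_vint.
  apply: rel_alg_closureV; last exact: RF.
  by apply: subring0; apply: subfield_subring; exact: Qgen_subfield.
by apply: contrapT => /(vmax_inv v x0).
Qed.

Lemma nonunitsMr x y : nonunits R x -> R y -> nonunits R (x * y).
Proof.
move=> [Rx hx] Ry; split; first exact: RM.
case: hx => [->|hx]; first by left; rewrite mul0r.
have [->|y0] := eqVneq y 0; first by left; rewrite mulr0.
right => h; apply: hx; have -> : x^-1 = y * (x * y)^-1 by rewrite invfM mulrCA mulfV // mulr1.
exact: RM.
Qed.

Lemma not_nonunits x : R x -> ~ nonunits R x <-> x != 0 /\ R x^-1.
Proof.
move=> Rx; split=> [h|[x0 RV] [_ [/eqP|//]]]; last by rewrite (negPf x0).
split; first by apply: contra_notN h => /eqP x0; split; [|left].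
by apply: contrapT => RV; apply: h; split; [|right].
Qed.

Lemma coarse_vunit x : R x -> vunit x -> R x^-1.
Proof. by move=> Rx [_ h]; case: (iffLR (not_nonunits Rx)) => // /coarse_vmax. Qed.

Lemma coarse_hensel (f : {poly K}) a : (forall i, R f`_i) -> R a ->
  nonunits R f.[a] -> ~ nonunits R f^`().[a] ->
  exists b, [/\ R b, f.[b] = 0 & nonunits R (b - a)].
Proof.
case: hR => _ H hf Ra h1 h2; have [|b [Rb /rootP rb h]] := H f a _ Ra h1 h2.
  by apply/polyOver_mem => //; exact: subring0.
by exists b.
Qed.

(* If all of Z[t] - {0} consists of units of R then Q(t) is contained in R,
   hence so is its algebraic closure F, against the properness of R. *)
Lemma coarse_nonunit : exists h, hornerz t h != 0 /\
  ~ (R (hornerz t h) /\ R (hornerz t h)^-1).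
Proof.
apply: contrapT => /forallNP H.
have Q c : Qgen [set t] c -> R c.
  case/Qgen1P => h [g [g0 ->]].
  have Rg : R (hornerz t g)^-1.
    by apply: contrapT => n; apply: (H g); split=> // -[].
  apply: RM => //; have [-> //|h0] := eqVneq (hornerz t h) 0; first exact: subring0.
  by apply: contrapT => n; apply: (H h); split=> // -[].
case: hR => -[_ [_ /existsNP[x /not_implyP[Fx nRx]]] hV] _.
apply: nRx; have [->|x0] := eqVneq x 0; first exact: subring0.
case: (hV x Fx x0) => // RV.
case: (Fx) => p [p0 hp /rootP rp].
have Q0 : Qgen [set t] 0 by apply: subring0; apply: subfield_subring; exact: Qgen_subfield.
move/(polyOver_mem _ Q0): hp => hp.
move: rp; rewrite horner_coef.
have : lead_coef p != 0 by rewrite lead_coef_eq0.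
have : size p != 0%N by rewrite size_poly_eq0.
rewrite /lead_coef; case: (size p) => // d _ /= pd0.
rewrite big_ord_recr /= => /eqP; rewrite addrC addr_eq0 => /eqP e.
case: d pd0 e => [|d] pd0 e.
  by move: e; rewrite big_ord0 oppr0 expr0 mulr1 => /eqP; rewrite (negPf pd0).
have -> : x = - \sum_(i < d.+1) (p`_d.+1)^-1 * p`_i * x^-1 ^+ (d - i).
  have xd : x ^+ d != 0 by exact: expf_neq0.
  apply: (mulIf xd); apply: (mulfI pd0); rewrite -exprS e mulNr mulrN; congr (- _).
  rewrite mulr_suml mulr_sumr; apply: eq_bigr => i _.
  rewrite !mulrA divff // mul1r -mulrA; congr (_ * _).
  have -> : x ^+ d = x ^+ (d - i) * x ^+ i by rewrite -exprD subnK // -ltnS.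
  by rewrite exprVn mulKf // expf_neq0.
apply: subringN => //; apply: subring_sum => // i _.
apply: RM; last exact: subringX.
apply: RM; last by apply: Q.
apply: Q; rewrite -[_^-1]mul1r.
by case/subfieldP: (Qgen_subfield [set t]) => h1 _; apply.
Qed.

Lemma coarse_F h : F (hornerz t h).
Proof.
by apply: sub_rel_alg_closure; [exact: Qgen_subfield|exact: Qgen1_hornerz].
Qed.

(** The equation y + y^2 q(y) = x coming from [expr_1D] has the residual root 0 in R, with
    derivative 1 there. *)
Lemma coarse_pow x n : nonunits R x -> exists y, 1 + n%:R ^+ 2 * x = y ^+ n.
Proof.
move=> hx; have Rx : R x by case: hx.
have [q Eq] := expr_1D n.
pose f : {poly K} := 'X + 'X ^+ 2 * map_poly intr q - x%:P.
have Rf i : R f`_i.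
  rewrite /f coefB coefC coefD coefX coefXnM; apply: RB; last first.
    by case: eqP => // _; exact: subring0.
  apply: subringD => //; first by case: eqP => // _; exact: subring0.
  by case: ifP => _; [exact: subring0|rewrite coef_map; exact: subring_int].
have [|||b [Rb rb _]] := coarse_hensel (f := f) (a := 0) Rf.
- exact: subring0.
- rewrite /f !(hornerD, hornerN, hornerM, hornerC, hornerX, hornerXn).
  rewrite !mul0r !add0r -mulN1r mulrC; apply: nonunitsMr => //.
  by apply: subringN.
- rewrite /f !derivE !(hornerD, hornerN, hornerM, hornerC, hornerX, hornerXn, hornerMn).
  rewrite addr0 !mul0r !addr0 subr0 => /coarse_vmax; exact: vmax1.
exists (1 + n%:R * b); rewrite Eq; congr (1 + _ * _).
move: rb; rewrite /f !(hornerD, hornerN, hornerM, hornerC, hornerX, hornerXn).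
by move/eqP; rewrite subr_eq0 => /eqP <-.
Qed.

End Ring.

Lemma prohenselian_coarse t : prohenselian v 1 -> vmax t -> t != 0 ->
  exists R, henselian_valuation_ring (rel_alg_closure (Qgen [set t])) R /\
    (rel_alg_closure (Qgen [set t]) `&` val_ring v `<=` R)%classic.
Proof.
move=> H ht t0; have := H 1%N (fun=> t) isT.
have -> : range (fun _ : 'I_1 => t) = [set t]%classic.
  by apply/seteqP; split=> [_ [_ _ <-] //|_ ->]; exists ord0.
apply; first by move=> _; split=> //; apply/vmax_ideal.
by move=> [[|i] hi] [[|j] hj].
Qed.

Section ResidueChar0.
Hypothesis rchar0 : residue_pchar0 v.

Lemma vunit_nat0 m : (0 < m)%N -> vunit m%:R.
Proof.
elim/ltn_ind: m => m IH m0.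
have [m1|m1] := leqP m 1.
  have -> : m = 1%N by lia.
  by split; [exact: vint1|exact: vmax1].
have pp := pdiv_prime m1; rewrite -(divnK (pdiv_dvd m)) natrM.
apply: vunitM.
  apply: IH; first by apply: ltn_Pdiv => //; exact: prime_gt1.
  by rewrite divn_gt0 ?pdiv_gt0 // pdiv_leq.
split; first exact: vint_nat.
by move/vmax_ideal => h; apply: (rchar0 (p := pdiv m)).
Qed.

Lemma vunit_int0 (m : int) : m != 0 -> vunit m%:~R.
Proof.
case: m => [[//|m]|m] _; rewrite ?NegzE ?mulrNz -pmulrn; last apply: vunitN.
  exact: vunit_nat0.
exact: vunit_nat0.
Qed.

Lemma vint_hornerz x h : vint x -> vint (hornerz x h).
Proof.
move=> hx; apply: vpoly_horner => // i; rewrite coef_map; exact: vint_int.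
Qed.

(** It suffices that x is a nonunit of R. Otherwise every nonzero element x^i (m + x g(x)) of Z[x]
    would be a unit of R, since m + x g(x) is a unit of O; this contradicts [coarse_nonunit]. *)
Lemma pow_residue0 x n : prohenselian v 1 -> vmax x ->
  exists y, 1 + n%:R ^+ 2 * x = y ^+ n.
Proof.
move=> H hx; have [->|x0] := eqVneq x 0.
  by exists 1; rewrite mulr0 addr0 expr1n.
have [R [hR hO]] := prohenselian_coarse H hx x0.
apply: (coarse_pow hR hO).
have Rx : R x.
  by apply: (coarse_vint hO); [have := coarse_F x 'X; rewrite hornerzX|exact: vmax_vint].
apply: contrapT => /(not_nonunits Rx) [_ RV].
have Rring : subring R by case: hR => -[].
have [h [h0]] := coarse_nonunit hR; apply.
split; first exact: subring_hornerz.
have hn0 : h != 0 by apply: contraNneq h0 => ->; rewrite /hornerz rmorph0 horner0.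
case: (poly_factorX hn0) => i [m [g [m0 e]]].
have -> : hornerz x h = x ^+ i * hornerz x (m%:P + 'X * g).
  by rewrite e hornerzM /hornerz map_polyXn hornerXn.
rewrite invfM; case/subringP: (Rring) => _ _; apply.
  by rewrite -exprVn; exact: subringX.
apply: (coarse_vunit hR hO); first exact: subring_hornerz.
rewrite hornerzD hornerzM hornerzC hornerzX; apply: vunitD; first exact: vunit_int0.
by apply: vmaxMr => //; apply: vint_hornerz; exact: vmax_vint.
Qed.

End ResidueChar0.

Section ResidueCharP.
Variable p : nat.
Hypothesis rcharp : residue_pchar v p.
Hypothesis htight : tight v p.
Hypothesis H1 : prohenselian v 1.

Let p_prime : prime p. Proof. by case: rcharp. Qed.
Let p_max : vmax p%:R. Proof. by apply/vmax_ideal; case: rcharp. Qed.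
Let p_neq0 : p%:R != 0 :> K.
Proof. by move/pcharf0P: char0 => ->; rewrite -lt0n prime_gt0. Qed.

Lemma vunit_coprime (m : int) : ~~ (p %| m)%Z -> vunit m%:~R.
Proof.
move=> h; have : coprimez m p.
  by rewrite coprimez_sym coprimezE /= prime_coprime // -dvdzE.
case/coprimezP => -[u w] /= e.
split; first exact: vint_int.
move=> hm; apply: (@vmax1 K G v); rewrite -[1](mulr1z 1) -e rmorphD !rmorphM /=.
by apply: vmaxD; apply: vmaxMl => //; exact: vint_int.
Qed.

Lemma vle_nat_expp m : (0 < m)%N -> exists N, vle m%:R (p%:R ^+ N).
Proof.
elim/ltn_ind: m => m IH m0.
have [/dvdnP[k e]|h] := boolP (p %| m)%N; last first.
  exists 0%N; rewrite expr0.
  have /vunitP/andP[] // : vunit m%:R by apply: (@vunit_coprime m); rewrite dvdzE.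
have k0 : (0 < k)%N by move: m0; rewrite e; case: (k).
have [|N hN] := IH k _ k0; first by rewrite e ltn_Pmulr // prime_gt1.
by exists N.+1; rewrite e natrM exprSr; apply: vleM2 => //; exact: vle_refl.
Qed.

Lemma vle_int_expp (m : int) : m != 0 -> exists N, vle m%:~R (p%:R ^+ N).
Proof.
case: m => [[//|m]|m] _; have [N hN] := vle_nat_expp (ltn0Sn m); exists N => //.
by rewrite NegzE mulrNz -pmulrn vleNl.
Qed.

(** The convex subgroup generated by v(x), called [H'] in the proof, is nonzero, so it contains the
    smallest one and with it v(p). *)
Lemma tight_archi x : vmax x -> x != 0 -> exists N, vle p%:R (x ^+ N).
Proof.
move=> hx x0; case: htight => H [_ Hmin [g vp Hg]].
case vx : (v x) => [a|]; last by move/val_inf/eqP: vx; rewrite (negPf x0).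
have vX n : v (x ^+ n) = Some (a *+ n).
  elim: n => [|n IH]; first by rewrite expr0 val_one mulr0n.
  by rewrite exprS val_mul vx IH /= mulrS.
have leD (b c d e : G) : b <= c -> d <= e -> b + d <= c + e.
  move=> bc de; apply: (@le_trans _ _ (b + e)); first exact: oag_lerD2l.
  by rewrite ![_ + e]addrC; exact: oag_lerD2l.
have leN (b c : G) : b <= c -> - c <= - b.
  by move=> bc; have := oag_lerD2l (- b - c) b c bc; rewrite subrK addrAC addNr add0r.
have na0 : ~~ (a <= 0) by move: hx; rewrite /val_small /val_le val_one vx.
have a0 : 0 <= a by case/orP: (oag_total 0 a) => // h; rewrite h in na0.
have an0 n : 0 <= a *+ n.
  by elim: n => [|n IH]; rewrite ?mulr0n // mulrS -[0]addr0; exact: leD.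
pose H' : set G := [set h | exists N, (- (a *+ N) <= h) /\ (h <= a *+ N)]%classic.
suff [N [_ hN]] : H' g by exists N; rewrite /val_le vp vX.
suff hH' : nonzero_convex_subgroup H' by exact: (Hmin _ hH' g Hg).
split; last first.
  apply: (ex_intro2 _ _ a); last by apply: (contraNneq _ na0) => ->; exact: lexx.
  exists 1%N; rewrite mulr1n; split; last exact: lexx.
  by apply: (le_trans _ (a0)); have := leN _ _ a0; rewrite oppr0.
split; first split.
- by apply/mem_set; exists 0%N; rewrite mulr0n oppr0.
- move=> b c /set_mem[N [b1 b2]] /set_mem[M [c1 c2]]; apply/mem_set.
  exists (N + M)%N; rewrite mulrnDr opprD; split; first by apply: leD => //; exact: leN.
  by apply: leD => //; rewrite -[a *+ M]opprK; exact: leN.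
- move=> b c [N [b1 b2]] c0 cb; exists N; split; last exact: le_trans b2.
  by apply: le_trans c0; have := leN _ _ (an0 N); rewrite oppr0.
Qed.

(** A nonzero integer divides a power of p in O. If p is a unit of R, the residue field of R
    therefore has characteristic 0. *)
Lemma coarse_int_unit t R (m : int) :
  henselian_valuation_ring (rel_alg_closure (Qgen [set t])) R ->
  (rel_alg_closure (Qgen [set t]) `&` val_ring v `<=` R)%classic ->
  R p%:R^-1 -> m != 0 -> R m%:~R^-1.
Proof.
move=> hR hO RpV m0; have Rring : subring R by case: hR => -[].
have mK0 : m%:~R != 0 :> K by rewrite intr_eq0_char0.
have Fsub := Qgen_subfield [set t]; have Fring := subfield_subring Fsub.
have [N hN] := vle_int_expp m0.
have -> : m%:~R^-1 = p%:R ^+ N / m%:~R * p%:R^-1 ^+ N :> K.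
  by rewrite exprVn mulrAC mulfV ?expf_neq0 // mul1r.
case/subringP: (Rring) => _ _; apply; last exact: subringX.
apply: (coarse_vint hO); last by apply/vint_div.
apply: sub_rel_alg_closure => //; case/subfieldP: (Fsub) => _ _; apply.
  exact (subringX _ Fring (subring_nat _ Fring)).
exact (subring_int _ Fring).
Qed.

Lemma hornerz_nat h : hornerz (p%:R : K) h = (h.[p%:Z])%:~R.
Proof. by rewrite /hornerz pmulrn horner_map. Qed.

(** Since Z[p] = Z, an R in which p is a unit would have all nonzero elements of Z[p] as units,
    against [coarse_nonunit]. *)
Lemma coarse_p R : 
  henselian_valuation_ring (rel_alg_closure (Qgen [set p%:R])) R ->
  (rel_alg_closure (Qgen [set p%:R]) `&` val_ring v `<=` R)%classic ->
  nonunits R p%:R.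
Proof.
move=> hR hO; have Rring : subring R by case: hR => -[].
apply: contrapT => /(not_nonunits (subring_nat p Rring)) [_ RpV].
have [h] := coarse_nonunit hR; rewrite hornerz_nat => -[h0]; apply.
split; first exact: subring_int.
apply: (coarse_int_unit hR hO RpV).
by rewrite intr_eq0_char0 in h0.
Qed.

(* Otherwise a would be a unit of R; a primitive integral equation of a reads
   a^j u + p z = 0 with u a unit, and p would be a unit of R as well. *)
Lemma pow_residuep_alg a h n : h != 0 -> hornerz a h = 0 -> vmax a ->
  exists y, 1 + n%:R ^+ 2 * a = y ^+ n.
Proof.
move=> h0 ra ha.
have [R [hR hO]] := prohenselian_coarse H1 p_max p_neq0.
have Rring : subring R by case: hR => -[].
have RM x y : R x -> R y -> R (x * y) by case/subringP: Rring => _ _; apply.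
apply: (coarse_pow hR hO).
have Fsub := Qgen_subfield [set p%:R : K]; have Fring := subfield_subring Fsub.
have Ra : R a.
  apply: (coarse_vint hO); last exact: vmax_vint.
  exists (map_poly intr h); split; last exact/rootP.
    by rewrite -size_poly_eq0 size_map_inj_poly ?size_poly_eq0 // => x y /eqP;
       rewrite -subr_eq0 -rmorphB intr_eq0_char0 // subr_eq0 => /eqP.
  apply/polyOver_mem; first exact: (subring0 Fring).
  by move=> i; rewrite coef_map; exact (subring_int _ Fring).
apply: contrapT => /(not_nonunits Ra) [a0 RV].
have [g gE] : exists g, g = zprimitive h by exists (zprimitive h).
have rg : hornerz a g = 0.
  move: ra; rewrite gE {1}(zpolyEprim h) /hornerz linearZ hornerZ /= => /eqP.
  by rewrite mulf_eq0 intr_eq0_char0 // zcontents_eq0 (negPf h0) /= => /eqP.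
have : exists j, ~~ (p %| g`_j)%Z.
  apply: contrapT => /forallNP H.
  have : (p %| zcontents g)%Z.
    by rewrite dvdz_contents; apply/polyOverP => i; apply: contrapT => /negP; exact: H.
  rewrite gE zcontents_primitive h0 dvdzE /= dvdn1 => /eqP p1.
  by move: p_prime; rewrite p1.
move=> ex; pose j := ex_minn ex.
have [hj hmin] : ~~ (p %| g`_j)%Z /\ forall i, (i < j)%N -> (p %| g`_i)%Z.
  rewrite /j; case: ex_minnP => k hk Hk; split=> // i ik.
  by apply: contraLR ik => /Hk; rewrite -leqNgt.
pose g1 := \poly_(i < j) (g`_i %/ p)%Z.
pose u := drop_poly j g.
have uE : hornerz a g = p%:R * hornerz a g1 + a ^+ j * hornerz a u.
  rewrite -[in LHS](poly_take_drop j g) hornerzD hornerzM; congr (_ + _); last first.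
    by rewrite mulrC /hornerz map_polyXn hornerXn.
  rewrite pmulrn -(hornerzC a) -hornerzM; congr hornerz; apply/polyP => i.
  rewrite coefCM coef_take_poly /g1 coef_poly; case: ltnP => [ij|_]; last by rewrite mulr0.
  by rewrite mulrC divzK // hmin.
have [u2 u2E] : exists u2, u = (g`_j)%:P + 'X * u2.
  exists (drop_poly 1 u); rewrite -[LHS](poly_take_drop 1 u) expr1 mulrC; congr (_ + _).
  apply/polyP => i; rewrite coef_take_poly coefC /u coef_drop_poly.
  by case: i => [|i]; rewrite ?add0n.
have uu : vunit (hornerz a u).
  rewrite u2E hornerzD hornerzM hornerzX hornerzC; apply: vunitD; first exact: vunit_coprime.
  by apply: vmaxMr => //; apply: vint_hornerz; exact: vmax_vint.
have RuV : R (hornerz a u)^-1.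
  by apply: (coarse_vunit hR hO) => //; exact: subring_hornerz.
have hn : nonunits R (p%:R * - hornerz a g1).
  apply: (nonunitsMr hR); first exact: coarse_p.
  by apply: subringN => //; exact: subring_hornerz.
move: rg; rewrite uE => /eqP; rewrite addr_eq0 => /eqP e.
move: hn; rewrite mulrN e opprK => -[_ []].
  by apply/eqP; rewrite mulf_neq0 ?expf_neq0 ?vunit_neq0 //; apply: (vunit_neq0 uu).
by apply; rewrite invfM -exprVn; apply: RM => //; exact: subringX.
Qed.

(** If x is a unit of R, then so is p, because p divides a power of x by tightness, and R has
    residue characteristic 0. In that case x is replaced, modulo the maximal ideal of R, by an
    element a algebraic over Q, to which [pow_residuep_alg] applies. *)
Lemma pow_residuep x n : vmax x ->
  exists y, 1 + n%:R ^+ 2 * x = y ^+ n.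
Proof.
move=> hx; have [->|x0] := eqVneq x 0.
  by exists 1; rewrite mulr0 addr0 expr1n.
have [->|n0] := eqVneq n 0%N.
  by exists 1; rewrite expr0n /= mul0r addr0 expr0.
have [R [hR hO]] := prohenselian_coarse H1 hx x0.
have Rring : subring R by case: hR => -[].
have RM y z : R y -> R z -> R (y * z) by case/subringP: Rring => _ _; apply.
have Fsub := Qgen_subfield [set x]; have Fring := subfield_subring Fsub.
have Fx : Qgen [set x] x by exact: Qgen_sub.
have Rx : R x.
  by apply: (coarse_vint hO); [exact: sub_rel_alg_closure|exact: vmax_vint].
have [hnx|] := pselect (nonunits R x); first exact: (coarse_pow hR hO).
move=> /(not_nonunits Rx) [_ RV].
have RpV : R p%:R^-1.
  have [N hN] := tight_archi hx x0.
  have -> : p%:R^-1 = x ^+ N / p%:R * x^-1 ^+ N.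
    by rewrite exprVn mulrAC mulfV ?expf_neq0 // mul1r.
  apply: RM; last exact: subringX.
  apply: (coarse_vint hO); last by apply/vint_div.
  apply: sub_rel_alg_closure => //; case/subfieldP: (Fsub) => _ _; apply.
    exact (subringX _ Fring Fx).
  exact (subring_nat _ Fring).
have RmV m : m != 0 -> R m%:~R^-1 by exact: (coarse_int_unit hR hO RpV).
have Rh h : R (hornerz x h) by exact: subring_hornerz.
(* A minimal polynomial of the residue of x in R, with integer coefficients. *)
have [h [h0 [nh hmin]]] : exists h : {poly int}, h != 0 /\ (nonunits R (hornerz x h) /\
    forall g : {poly int}, (size g < size h)%N -> g != 0 -> ~ nonunits R (hornerz x g)).
  have ex : exists k, `[< exists h : {poly int}, [/\ size h = k, h != 0 & nonunits R (hornerz x h)] >].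
    have [h [h0 nh]] := coarse_nonunit hR; exists (size h); apply/asboolP; exists h; split=> //.
      by apply: contraNneq h0 => ->; rewrite /hornerz rmorph0 horner0.
    split=> //; right=> h'; apply: nh; split=> //.
  case: (ex_minnP ex) => k /asboolP[h [hk h0 nh]] Hk; exists h; split=> //; split=> // g.
  rewrite hk => gk g0 ng; move: gk; rewrite ltnNge => /negP; apply; apply: Hk.
  by apply/asboolP; exists g.
have h2 : (1 < size h)%N.
  rewrite ltnNge; apply/negP => /size1_polyC e; move: nh h0; rewrite e hornerzC polyC_eq0.
  move=> [_ [/eqP h'|h']] m0; last by apply: h'; exact: RmV.
  by rewrite intr_eq0_char0 // (negPf m0) in h'.
(* By minimality h'(x) is a unit of R, so x lifts to a root a of h with a - x a nonunit of R, in
   particular in M. *)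
have [||||a [Ra ra na]] := coarse_hensel hR (f := map_poly intr h) (a := x).
- by move=> i; rewrite coef_map; exact: subring_int.
- by [].
- by [].
- rewrite deriv_map; apply: hmin; first by rewrite lt_size_deriv.
  by apply: deriv_neq0 => //; exact: Num.Theory.pchar_num.
have ha : vmax a.
  have := vmaxD hx (coarse_vmax hR hO na); by rewrite addrC subrK.
have [c hc] := pow_residuep_alg n h0 ra ha.
pose w := 1 + n%:R ^+ 2 * a.
have wu : vunit w by apply: vunit1D; apply: vmaxMl => //; apply: vintX; exact: vint_nat.
have R1 : R 1 by case/subringP: Rring.
have Rw : R w by apply: subringD => //; apply: RM => //; apply: subringX => //; exact: subring_nat.
have RwV := coarse_vunit hR hO Rw wu.
(* The quotient of 1 + n^2 x by w = 1 + n^2 a is 1 modulo the maximal ideal of R, and n is a unit of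
   R: the quotient is an n-th power b^n by Hensel's lemma at 1. *)
pose f : {poly K} := w%:P * 'X^n - (1 + n%:R ^+ 2 * x)%:P.
have fE y : f.[y] = w * y ^+ n - (1 + n%:R ^+ 2 * x).
  by rewrite /f !(hornerD, hornerN, hornerM, hornerC, hornerXn).
have Rn2 : R (n%:R ^+ 2) by apply: subringX => //; exact: subring_nat.
have Rwx : R (1 + n%:R ^+ 2 * x) by apply: subringD => //; exact: RM.
have [||||b [Rb rb _]] := coarse_hensel hR (f := f) (a := 1).
- move=> i; rewrite /f coefB coefCM coefXn coefC.
  case/subringP: (Rring) => _ RB _; apply: RB; last by case: eqP => // _; exact: subring0.
  by apply: RM => //; case: eqP => _; [|exact: subring0].
- by [].
- rewrite fE expr1n mulr1.
  have -> : w - (1 + n%:R ^+ 2 * x) = (a - x) * n%:R ^+ 2 by rewrite /w; ring.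
  exact: (nonunitsMr hR).
- have -> : f^`().[1] = w * n%:R.
    by rewrite /f derivB derivC subr0 derivM derivC mul0r add0r derivXn !hornerE hornerMn hornerXn expr1n.
  apply/not_nonunits; first by apply: RM => //; exact: subring_nat.
  split; first by rewrite mulf_neq0 ?(vunit_neq0 wu) // pmulrn intr_eq0_char0.
  rewrite invfM; apply: RM => //; rewrite pmulrn; exact: RmV.
exists (c * b); move: rb; rewrite fE exprMn -hc => /eqP; rewrite subr_eq0 => /eqP <-.
by [].
Qed.

End ResidueCharP.

End Coarsening.

(** * Definable sets and quantifier-free formulas *)

Section Definable.
Variables (K : fieldType) (G : orderedAbelianGroupType) (v : valuation K G).
Local Notation M := (mac_structure v).

(** Definability is treated semantically, through closure properties, so that formulas are assembled
    without substituting or renaming variables. *)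
Definition definable n (S : ('I_n -> K) -> Prop) :=
  exists phi : formula LMacD n, forall e, S e <-> sat (M := M) phi e.

Definition termfun n (f : ('I_n -> K) -> K) :=
  exists t : term LMacD n, forall e, eval (M := M) e t = f e.

Lemma termfun_var n (i : 'I_n) : termfun (fun e => e i).
Proof. by exists (Var LMacD i). Qed.

Definition ord0_elim (T : Type) (i : 'I_0) : T :=
  match notF (ltn_ord i) with end.

Definition pair_arg (T : Type) (a b : T) (i : 'I_2) : T :=
  if i == ord0 then a else b.

Lemma termfun0 n : termfun (fun _ : 'I_n -> K => 0).
Proof. by exists (@App LMacD n MacZero (@ord0_elim _)). Qed.

Lemma termfun1 n : termfun (fun _ : 'I_n -> K => 1).
Proof. by exists (@App LMacD n MacOne (@ord0_elim _)). Qed.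

Lemma termfunD n (f g : ('I_n -> K) -> K) :
  termfun f -> termfun g -> termfun (fun e => f e + g e).
Proof.
move=> [s hs] [t ht]; exists (@App LMacD n MacAdd (pair_arg s t)) => e.
by rewrite -hs -ht.
Qed.

Lemma termfunM n (f g : ('I_n -> K) -> K) :
  termfun f -> termfun g -> termfun (fun e => f e * g e).
Proof.
move=> [s hs] [t ht]; exists (@App LMacD n MacMul (pair_arg s t)) => e.
by rewrite -hs -ht.
Qed.

Lemma termfun_div n (f g : ('I_n -> K) -> K) :
  termfun f -> termfun g -> termfun (fun e => restricted_div v (f e) (g e)).
Proof.
move=> [s hs] [t ht]; exists (@App LMacD n MacD (pair_arg s t)) => e.
by rewrite -hs -ht.
Qed.

Lemma termfun_nat n m : termfun (fun _ : 'I_n -> K => m%:R).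
Proof.
elim: m => [|m IH]; first exact: termfun0.
have [t ht] := termfunD IH (termfun1 n).
by exists t => e; rewrite ht natr1.
Qed.

Lemma termfunX n (f : ('I_n -> K) -> K) m :
  termfun f -> termfun (fun e => f e ^+ m).
Proof.
move=> hf; elim: m => [|m IH]; first exact: termfun1.
have [t ht] := termfunM hf IH.
by exists t => e; rewrite ht exprS.
Qed.

Lemma termfun_sum n (I : Type) (r : seq I) (f : I -> ('I_n -> K) -> K) :
  (forall i, termfun (f i)) -> termfun (fun e => \sum_(i <- r) f i e).
Proof.
move=> hf; elim: r => [|i r IH].
  by have [t ht] := termfun0 n; exists t => e; rewrite ht big_nil.
have [t ht] := termfunD (hf i) IH.
by exists t => e; rewrite ht big_cons.
Qed.

Lemma definable_ext n (S S' : ('I_n -> K) -> Prop) :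
  (forall e, S e <-> S' e) -> definable S -> definable S'.
Proof. by move=> h [phi hphi]; exists phi => e; rewrite -h. Qed.

Lemma definable_eq n (f g : ('I_n -> K) -> K) :
  termfun f -> termfun g -> definable (fun e => f e = g e).
Proof.
by move=> [s hs] [t ht]; exists (Feq s t) => e /=; rewrite -hs -ht.
Qed.

Lemma definable_imp n (S S' : ('I_n -> K) -> Prop) :
  definable S -> definable S' -> definable (fun e => S e -> S' e).
Proof.
by move=> [s hs] [t ht]; exists (Fimp s t) => e /=; rewrite hs ht.
Qed.

Lemma definable_not n (S : ('I_n -> K) -> Prop) :
  definable S -> definable (fun e => ~ S e).
Proof.
by move=> [s hs]; exists (Fimp s (Fbot LMacD n)) => e /=; rewrite hs.
Qed.

Lemma definable_and n (S S' : ('I_n -> K) -> Prop) :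
  definable S -> definable S' -> definable (fun e => S e /\ S' e).
Proof.
move=> hS hS'; apply: (definable_ext (S := fun e => ~ (S e -> ~ S' e))).
  by move=> e; split=> [h|[a b] h]; [apply: contrapT => h'; apply: h => a b; apply: h'|exact: (h a b)].
by apply: definable_not; apply: definable_imp => //; exact: definable_not.
Qed.

Lemma definable_ex n (S : ('I_n.+1 -> K) -> Prop) :
  definable S -> definable (fun e => exists x, S (extend x e)).
Proof.
move=> [s hs]; exists (Fex s) => e /=.
by split=> -[x hx]; exists x; apply/hs.
Qed.

Lemma definable_all n (S : ('I_n.+1 -> K) -> Prop) :
  definable S -> definable (fun e => forall x, S (extend x e)).
Proof.
move=> [s hs]; exists (Fall s) => e /=.
by split=> h x; apply/hs; exact: h.
Qed.

Definition cat_env m n (c : 'I_m -> K) (e : 'I_n -> K) (i : 'I_(m + n)) : K :=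
  match split i with inl j => c j | inr j => e j end.

Lemma extend0 n (x : K) (e : 'I_n -> K) : extend x e ord0 = x.
Proof. by rewrite /extend unlift_none. Qed.

Lemma extend_lift n (x : K) (e : 'I_n -> K) j : extend x e (lift ord0 j) = e j.
Proof. by rewrite /extend liftK. Qed.

Lemma cat_envl m n (c : 'I_m -> K) (e : 'I_n -> K) j : cat_env c e (lshift n j) = c j.
Proof. by rewrite /cat_env (unsplitK (inl j)). Qed.

Lemma cat_envr m n (c : 'I_m -> K) (e : 'I_n -> K) j : cat_env c e (rshift m j) = e j.
Proof. by rewrite /cat_env (unsplitK (inr j)). Qed.

Lemma extend_cat m n (x : K) (c : 'I_m -> K) (e : 'I_n -> K) :
  extend x (cat_env c e) = cat_env (extend x c) e :> ('I_(m.+1 + n) -> K).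
Proof.
apply/funext => i; rewrite {1}/extend; case: unliftP => [j|] ->; last first.
  have -> : ord0 = lshift n (ord0 : 'I_m.+1) :> 'I_(m.+1 + n) by exact: val_inj.
  by rewrite cat_envl extend0.
case: (splitP j) => k jk.
  have -> : j = lshift n k by exact: val_inj.
  have -> : lift ord0 (lshift n k) = lshift n (lift ord0 k) :> 'I_(m.+1 + n) by exact: val_inj.
  by rewrite !cat_envl extend_lift.
have -> : j = rshift m k by exact: val_inj.
have -> : lift ord0 (rshift m k) = rshift m.+1 k :> 'I_(m.+1 + n) by exact: val_inj.
by rewrite !cat_envr.
Qed.

Lemma definable_all_block m n (S : ('I_(m + n) -> K) -> Prop) :
  definable S -> definable (fun e => forall c : 'I_m -> K, S (cat_env c e)).
Proof.
elim: m S => [|m IH] S hS.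
  apply: (definable_ext _ hS) => e; have E c : cat_env c e = e.
    apply/funext => i; case: (splitP (i : 'I_(0 + n))) => [[]//|j ij].
    have -> : i = rshift 0 j by exact: val_inj.
    by rewrite cat_envr; congr e; exact: val_inj.
  by split=> [h c|/(_ (@ord0_elim _))]; rewrite E.
apply: (definable_ext _ (IH _ (definable_all hS))) => e; split=> h c.
  have -> : c = extend (c ord0) (fun j => c (lift ord0 j)).
    by apply/funext => i; rewrite /extend; case: unliftP => [j|] ->.
  by rewrite -extend_cat.
by move=> x; rewrite extend_cat; exact: h.
Qed.

(** The default value 0 makes D express the valuation without quantifiers: x is in O iff D(x,1) = x,
    in M iff D(1,x) = 0, and v(x) <= v(y) iff D(y,x) x = y. *)
Lemma definable_vint n (f : ('I_n -> K) -> K) :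
  termfun f -> definable (fun e => val_integral v (f e)).
Proof.
move=> hf; apply: (definable_ext _ (definable_eq (termfun_div hf (termfun1 n)) hf)) => e.
rewrite /restricted_div /val_integral /val_le oner_neq0 andbT divr1.
by case: ifP => [//|nh]; split=> // h; have := vle0 v 1; rewrite /val_le h nh.
Qed.

Lemma definable_vmax n (f : ('I_n -> K) -> K) :
  termfun f -> definable (fun e => val_small v (f e)).
Proof.
move=> hf; apply: (definable_ext _ (definable_eq (termfun_div (termfun1 n) hf) (termfun0 n))) => e.
rewrite /restricted_div /val_small /val_le mul1r.
have [->|f0] := eqVneq (f e) 0.
  rewrite andbF; split=> // _; exact: vmax0.
rewrite andbT; case: ifP => // h; split=> // /eqP; rewrite invr_eq0 (negPf f0) //.
Qed.

Lemma definable_vle n (f g : ('I_n -> K) -> K) :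
  termfun f -> termfun g -> definable (fun e => val_le v (f e) (g e)).
Proof.
move=> hf hg; apply: (definable_ext _ (definable_eq (termfunM (termfun_div hg hf) hf) hg)) => e.
rewrite /restricted_div; have [->|f0] := eqVneq (f e) 0.
  rewrite mulr0; split=> [<-|/vle_0 //]; exact: vle0.
rewrite andbT /val_le; case: ifP => h; first by rewrite divfK.
by rewrite mul0r; split=> // e0; have := vle0 v (f e); rewrite /val_le e0 h.
Qed.

Lemma qe_definable n (S : ('I_n -> K) -> Prop) :
  admits_QE (Th M) -> definable S ->
  exists2 psi : formula LMacD n, quantifier_free psi &
    forall e, S e <-> sat (M := M) psi e.
Proof.
move=> qe [phi hphi]; have [psi [qf H]] := qe n phi.
exists psi => // e; rewrite hphi; apply: H => chi h; exact: h.
Qed.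

End Definable.

(** * Quantifier-free formulas along an ultrafilter *)

Section Transfer.
Variables (K : fieldType) (G : orderedAbelianGroupType) (v : valuation K G).
Local Notation M := (mac_structure v).
Local Notation vle := (val_le v).
Local Open Scope classical_set_scope.
Variables (J T : Type) (U : set_system J) (B : J -> set T).
Hypothesis ultraU : UltraFilter U.
Variables (P : idomainType) (ev : T -> {rmorphism P -> K}).

Definition is_power m (x : K) := exists y, x = y ^+ m.

Hypothesis ev_neq0 : forall p, p != 0 ->
  U [set j | forall b, B j b -> ev b p != 0].
Hypothesis ev_vle : forall p q, p != 0 -> q != 0 ->
  U [set j | forall b b', B j b -> B j b' ->
               vle (ev b p) (ev b q) -> vle (ev b' p) (ev b' q)].
Hypothesis ev_power : forall m p q, (1 < m)%N -> p != 0 -> q != 0 ->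
  U [set j | forall b b', B j b -> B j b' ->
               is_power m (ev b p / ev b q) -> is_power m (ev b' p / ev b' q)].

Let FU : Filter U := @filter_filter _ _ (@ultra_proper _ _ ultraU).
Let UT : U setT. Proof. exact: (@filterT _ _ FU). Qed.
Let UI A C : U A -> U C -> U (A `&` C). Proof. exact: (@filterI _ _ FU). Qed.
Let US A C : A `<=` C -> U A -> U C. Proof. exact: (@filterS _ _ FU). Qed.

(** On a large set of indices a term is a single fraction over P. The only case distinction lies in
    D, and the ultrafilter chooses one of its branches. *)
Lemma transfer_term n (x : 'I_n -> P) (t : term LMacD n) :
  exists p q : P, (q != 0) /\ U [set j | forall b, B j b -> eval (M := M) (fun i => ev b (x i)) t = ev b p / ev b q].
Proof.
elim: t => [i|f a IH].
  exists (x i), 1; rewrite oner_neq0; split=> //.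
  by apply: US UT => j _ b _ /=; rewrite rmorph1 divr1.
case: f a IH => /= a IH.
- exists 0, 1; rewrite oner_neq0; split=> //.
  by apply: US UT => j _ b _ /=; rewrite rmorph0 mul0r.
- exists 1, 1; rewrite oner_neq0; split=> //.
  by apply: US UT => j _ b _ /=; rewrite rmorph1 divr1.
- have [p [q [q0 h]]] := IH ord0; have [p' [q' [q0' h']]] := IH ord_max.
  exists (p * q' + p' * q), (q * q'); rewrite mulf_neq0 //; split=> //.
  have := UI (UI h h') (UI (ev_neq0 q0) (ev_neq0 q0')).
  apply: US => j [[hj hj'] [nj nj']] b Bb /=; rewrite hj // hj' //.
  by rewrite rmorphD !rmorphM /= addf_div ?nj ?nj'.
- have [p [q [q0 h]]] := IH ord0; exists (- p), q; split=> //.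
  by apply: US h => j hj b Bb /=; rewrite hj // rmorphN mulNr.
- have [p [q [q0 h]]] := IH ord0; have [p' [q' [q0' h']]] := IH ord_max.
  exists (p * p'), (q * q'); rewrite mulf_neq0 //; split=> //.
  apply: US (UI h h') => j [hj hj'] b Bb /=; rewrite hj // hj' //.
  by rewrite !rmorphM /= mulf_div.
have [p [q [q0 h]]] := IH ord0; have [p' [q' [q0' h']]] := IH ord_max.
have zero : U [set j | forall b, B j b ->
    restricted_div v (ev b p / ev b q) (ev b p' / ev b q') = 0] ->
    exists p q : P, (q != 0) /\ U [set j | forall b, B j b ->
      restricted_div v (eval (M := M) (fun i => ev b (x i)) (a ord0))
         (eval (M := M) (fun i => ev b (x i)) (a ord_max)) = ev b p / ev b q].
  move=> Z; exists 0, 1; rewrite oner_neq0; split=> //.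
  apply: US (UI Z (UI h h')) => j [zj [hj hj']] b Bb /=.
  by rewrite hj // hj' // zj // rmorph0 mul0r.
have [p'0|p'0] := eqVneq p' 0.
  apply: zero; apply: US UT => j _ b _ /=.
  by rewrite /restricted_div p'0 rmorph0 mul0r eqxx andbF.
have [p0|p0] := eqVneq p 0.
  apply: zero; apply: US UT => j _ b _ /=.
  by rewrite /restricted_div p0 rmorph0 !mul0r; case: ifP.
have n1 : p' * q != 0 by rewrite mulf_neq0.
have n2 : p * q' != 0 by rewrite mulf_neq0.
have N : U [set j | forall b, B j b ->
  [/\ ev b p != 0, ev b q != 0, ev b p' != 0 & ev b q' != 0]].
  have := UI (UI (ev_neq0 p0) (ev_neq0 q0)) (UI (ev_neq0 p'0) (ev_neq0 q0')).
  by apply: US => j [[a1 a2] [a3 a4]] b Bb; split; [exact: a1|exact: a2|exact: a3|exact: a4].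
have D b : ev b p != 0 -> ev b q != 0 -> ev b p' != 0 -> ev b q' != 0 ->
    restricted_div v (ev b p / ev b q) (ev b p' / ev b q') =
    if vle (ev b (p' * q)) (ev b (p * q')) then ev b (p * q') / ev b (q * p') else 0.
  move=> b1 b2 b3 b4; rewrite /restricted_div mulf_neq0 ?invr_eq0 // andbT.
  have -> : leV (v (ev b p' / ev b q')) (v (ev b p / ev b q)) = vle (ev b (p' * q)) (ev b (p * q')).
    rewrite -[LHS](@vleMr K G v (ev b q * ev b q')) ?mulf_neq0 // !rmorphM /=.
    by congr vle; field; rewrite ?b2 ?b4.
  case: ifP => // _; rewrite !rmorphM /=; field; rewrite ?b2 ?b3 ?b4 //.
have [A|A] := in_ultra_setVsetC [set j | forall b, B j b -> vle (ev b (p' * q)) (ev b (p * q'))] ultraU.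
  exists (p * q'), (q * p'); rewrite mulf_neq0 //; split=> //.
  apply: US (UI (UI h h') (UI N A)) => j [[hj hj'] [nj aj]] b Bb /=.
  by rewrite hj // hj' //; case: (nj b Bb) => *; rewrite D // aj.
(* The complement only yields one point c of [B j] where the division is undefined; [ev_vle] carries
   this to all points. *)
apply: zero; apply: US (UI A (UI N (ev_vle n1 n2))) => j [/existsNP[c /not_implyP[Bc nc]] [nj ej]] b Bb.
case: (nj b Bb) => *; rewrite D //; case: ifP => // h1; case: nc; exact: ej h1.
Qed.

(** The implication between two arbitrary points of [B j] is its own converse after exchanging them,
    which is what the premise of an implication needs. The sets [B j] will be sets of small powers
    z, and balls in the space of polynomials. *)
Lemma transfer_qf n (phi : formula LMacD n) (x : 'I_n -> P) : quantifier_free phi ->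
  U [set j | forall b b', B j b -> B j b' ->
       sat (M := M) phi (fun i => ev b (x i)) -> sat (M := M) phi (fun i => ev b' (x i))].
Proof.
elim: phi x => {n} [n|n s t|n r a|n phi IH psi IH'|n phi IH|n phi IH] x //=.
- by move=> _; apply: US UT => j _ b b' _ _ [].
- move=> _; have [p [q [q0 h]]] := transfer_term x s; have [p' [q' [q0' h']]] := transfer_term x t.
  pose d := p * q' - p' * q.
  have E : U [set j | forall b, B j b -> (eval (M := M) (fun i => ev b (x i)) s =
      eval (M := M) (fun i => ev b (x i)) t) <-> ev b d = 0].
    apply: US (UI (UI h h') (UI (ev_neq0 q0) (ev_neq0 q0'))) => j.
    move=> [[hj hj'] [nj nj']] b Bb; rewrite hj // hj' // /d rmorphB !rmorphM /=.
    split=> H; apply/eqP; first by rewrite subr_eq0 -eqr_div ?nj ?nj' //; exact/eqP.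
    by rewrite eqr_div ?nj ?nj' // -subr_eq0; exact/eqP.
  have [d0|d0] := eqVneq d 0.
    by apply: US E => j ej b b' Bb Bb' _; apply/ej; rewrite // d0 rmorph0.
  apply: US (UI E (ev_neq0 d0)) => j [ej nj] b b' Bb Bb' /ej => /(_ Bb)/eqP.
  by rewrite (negPf (nj _ Bb)).
- move=> _; case: r a => m m1 a /=.
  have [p [q [q0 h]]] := transfer_term x (a ord0).
  have [p0|p0] := eqVneq p 0.
    apply: US h => j hj b b' Bb Bb' [].
    by rewrite hj // p0 rmorph0 mul0r eqxx.
  apply: US (UI (UI h (ev_power m1 p0 q0)) (UI (ev_neq0 p0) (ev_neq0 q0))) => j.
  move=> [[hj ej] [nj nj']] b b' Bb Bb' [_]; rewrite !hj // => pw.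
  by split; [rewrite mulf_neq0 ?invr_eq0 ?nj ?nj'|exact: ej pw].
move=> [h1 h2]; apply: US (UI (IH x h1) (IH' x h2)) => j [e1 e2] b b' Bb Bb' H H'.
by apply: (e2 b b') => //; apply: H; exact: (e1 b' b).
Qed.

End Transfer.

(** * Approximate roots *)

Lemma definable_all_ord (K : fieldType) (G : orderedAbelianGroupType)
    (v : valuation K G) n m (S : 'I_m -> ('I_n -> K) -> Prop) :
  (forall i, definable v (S i)) -> definable v (fun e => forall i, S i e).
Proof.
move=> hS.
suff H (r : seq 'I_m) : definable v (fun e => forall i, i \in r -> S i e).
  apply: (definable_ext _ (H (enum 'I_m))) => e.
  by split=> h i; [apply: h; rewrite mem_enum|move=> _; exact: h].
elim: r => [|i r IH].
  apply: (definable_ext _ (definable_eq (termfun0 v n) (termfun0 v n))) => e.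
  by split.
apply: (definable_ext _ (definable_and (hS i) IH)) => e; split=> [[h1 h2] j|h].
  by rewrite inE => /orP[/eqP -> //|]; exact: h2.
by split=> [|j hj]; apply: h; rewrite inE ?eqxx // hj orbT.
Qed.

Section Powers.
Variable (K : fieldType).
Implicit Types (a b u z : K).

Lemma is_powerM m a b : is_power m a -> is_power m b -> is_power m (a * b).
Proof. by move=> [x ->] [y ->]; exists (x * y); rewrite exprMn. Qed.

Lemma is_powerV m a : is_power m a -> is_power m a^-1.
Proof. by move=> [x ->]; exists x^-1; rewrite exprVn. Qed.

Lemma is_powerMr m a b : b != 0 -> is_power m b -> is_power m (a * b) <-> is_power m a.
Proof.
move=> b0 hb; split=> h; last exact: is_powerM.
by rewrite -[a](mulfK b0); apply: is_powerM => //; exact: is_powerV.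
Qed.

Lemma is_powerX m a n : is_power m a -> is_power m (a ^+ n).
Proof. by move=> [x ->]; exists (x ^+ n); rewrite exprAC. Qed.

Lemma is_power_fact m N u : (0 < m <= N)%N -> is_power m (u ^+ N`!).
Proof.
move=> hm; have /dvdnP[k ->] : (m %| N`!)%N by exact: dvdn_fact.
by exists (u ^+ k); rewrite exprM.
Qed.

End Powers.

Section Approximation.
Variables (K : fieldType) (G : orderedAbelianGroupType) (v : valuation K G).
Hypothesis char0 : [pchar K] =i pred0.
Hypothesis qe : admits_QE (Th (mac_structure v)).
Hypothesis hpow : forall n x, val_small v x -> is_power n (1 + n%:R ^+ 2 * x).
Local Notation M := (mac_structure v).
Local Notation vle := (val_le v).
Local Notation vmax := (val_small v).
Local Notation vint := (val_integral v).
Local Notation vunit := (val_unit v).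

(** * Polynomials over [R0] at arguments of large value *)

Section Asymptotics.
Variables (R0 : idomainType) (iota : {rmorphism R0 -> K}) (y0 : R0).
Local Notation y := (iota y0).
Hypothesis y_max : vmax y.
Hypothesis y_neq0 : y != 0.
Hypothesis iota_vint : forall a, vint (iota a).
Hypothesis iota_archi : forall a, a != 0 -> exists N, vle (iota a) (y ^+ N).

Let y_int : vint y. Proof. exact: vmax_vint. Qed.

Lemma iota_neq0 a : a != 0 -> iota a != 0.
Proof.
move=> /iota_archi[N h]; apply: (vle_neq0 h); exact: expf_neq0.
Qed.

Definition ev_at (z : K) : {rmorphism {poly R0} -> K} := horner_eval z \o map_poly iota.

Lemma ev_atE z p : ev_at z p = (map_poly iota p).[z]. Proof. by []. Qed.

Lemma ev_at_vint z p : vint z -> vint (ev_at z p).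
Proof.
by move=> hz; rewrite ev_atE; apply: vpoly_horner => // i; rewrite coef_map; exact: iota_vint.
Qed.

Lemma is_power_1D m : (0 < m)%N -> exists k, forall x, vle (y ^+ k) x -> is_power m (1 + x).
Proof.
move=> m0; have mR0 : m%:R != 0 :> R0.
  apply: contraTneq isT => h; have := rmorph_nat iota m; rewrite h rmorph0 => /esym/eqP.
  by move/pcharf0P: (char0) => ->; rewrite (gtn_eqF m0).
have [N] := iota_archi mR0; rewrite rmorph_nat => hN.
(* As m^2 divides y^(2N), the one extra factor y puts x / m^2 into M. *)
exists (N * 2).+1 => x hx.
have n2 : m%:R ^+ 2 != 0 :> K.
  by rewrite expf_neq0 // -(rmorph_nat iota) iota_neq0.
have -> : x = m%:R ^+ 2 * (x / m%:R ^+ 2) by rewrite mulrC divfK.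
apply: hpow; apply: (vmax_vle _ y_max).
rewrite -(@vleMr _ _ v (m%:R ^+ 2)) // divfK //; apply: vle_trans hx.
by rewrite [X in val_le _ _ X]exprS; apply: vleM; rewrite exprM; exact: vleX.
Qed.

(** The lowest term a z^i dominates: the relative error is an integral multiple of z / a, and a
    divides a power of y. *)
Lemma asymptotics p : p != 0 -> exists a i, a != 0 /\ forall k, exists N,
  forall z, z != 0 -> vle (y ^+ N) z ->
  exists2 x, vle (y ^+ k) x & ev_at z p = iota a * z ^+ i * (1 + x).
Proof.
case/poly_factorX => i [a [g [a0 ->]]]; exists a, i; split=> // k.
have [N hN] := iota_archi a0; have ia0 := iota_neq0 a0.
exists (N + k)%N => z z0 hz.
have zint : vint z by apply: vle_trans hz; exact: vintX.
exists (z * ev_at z g / iota a).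
  rewrite -(@vleMr _ _ v (iota a)) // divfK //; apply: vleMint; first exact: ev_at_vint.
  apply: vle_trans hz; rewrite exprD [X in vle X _]mulrC; apply: vleM2 => //; exact: vle_refl.
rewrite rmorphM rmorphD rmorphM !ev_atE !map_polyXn map_polyX map_polyC /= hornerXn hornerC hornerX.
by field.
Qed.

Local Open Scope classical_set_scope.

(** The N!-th powers are m-th powers for every m <= N, so that no P_m with m <= N separates two
    elements of this set. *)
Definition large (N : nat) : set K :=
  [set z | [/\ z != 0, vle (y ^+ N) z & exists u, z = u ^+ N`!]].

Lemma large_le N N' z : (N <= N')%N -> large N' z -> z != 0 /\ vle (y ^+ N) z.
Proof.
by move=> h [z0 hz _]; split=> //; apply: vle_trans hz; exact: vle_expl.
Qed.

(** Up to units, a z^i is compared with b z^j. As z is divisible by more than a and b, the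
    comparison holds for i < j, fails for i > j, and for i = j depends on a and b alone. *)
Lemma large_vle p q : p != 0 -> q != 0 -> exists N0, forall N, (N0 <= N)%N ->
  forall z z', large N z -> large N z' ->
    vle (ev_at z p) (ev_at z q) -> vle (ev_at z' p) (ev_at z' q).
Proof.
move=> /asymptotics[a [i [a0 Hp]]] /asymptotics[b [j [b0 Hq]]].
have [Np hp] := Hp 1%N; have [Nq hq] := Hq 1%N.
have [Na ha] := iota_archi a0; have [Nb hb] := iota_archi b0.
exists (Np + Nq + Na + Nb).+1 => N hN z z' lz lz'.
have E u : large N u ->
    vle (ev_at u p) (ev_at u q) = vle (iota a * u ^+ i) (iota b * u ^+ j).
  move=> lu; have [u0 hu] := @large_le Np N _ ltac:(lia) lu.
  have [_ hu'] := @large_le Nq N _ ltac:(lia) lu.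
  have [x hx ->] := hp u u0 hu; have [x' hx' ->] := hq u u0 hu'.
  have ux : vunit (1 + x) by apply: vunit1D; apply: (vmax_vle hx).
  have ux' : vunit (1 + x') by apply: vunit1D; apply: (vmax_vle hx').
  by rewrite vle_unitM // vle_unitMr.
have lint u : large N u -> vint u.
  by move=> /(large_le (leq0n N)) [_ h]; rewrite /val_integral -(expr0 y).
rewrite !E //; have ia0 := iota_neq0 a0; have ib0 := iota_neq0 b0.
have [z0 _] := large_le (leq0n N) lz; have [z0' _] := large_le (leq0n N) lz'.
case: (ltngtP i j) => ij.
- move=> _; have [_ hza] := @large_le Na N _ ltac:(lia) lz'.
  have -> : z' ^+ j = z' ^+ (j - i).-1 * z' * z' ^+ i.
    by rewrite -exprSr -exprD prednK ?subn_gt0 // subnK // ltnW.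
  rewrite !mulrA vleMr ?expf_neq0 // mulrC; apply: vleMint; last exact: vle_trans hza.
  by apply: vintM; [exact: iota_vint|apply: vintX; exact: lint].
- have [_ hzb] := @large_le Nb.+1 N _ ltac:(lia) lz.
  have -> : z ^+ i = z ^+ (i - j).-1 * z * z ^+ j.
    by rewrite -exprSr -exprD prednK ?subn_gt0 // subnK // ltnW.
  rewrite !mulrA vleMr ?expf_neq0 // => h; exfalso.
  have : vle (y ^+ Nb.+1) (y ^+ Nb).
    apply: vle_trans hb; apply: vle_trans h; apply: (vle_trans hzb).
    rewrite mulrC; apply: vleMint; last exact: vle_refl.
    by apply: vintM; [exact: iota_vint|apply: vintX; exact: lint].
  rewrite exprS -[X in vle _ X]mul1r vleMr ?expf_neq0 // => h'.
  by move: y_max; rewrite /val_small h'.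
- by rewrite ij !vleMr ?expf_neq0.
Qed.

Lemma large_neq0 p : p != 0 -> exists N0, forall N, (N0 <= N)%N ->
  forall z, large N z -> ev_at z p != 0.
Proof.
move=> /asymptotics[a [i [a0 Hp]]]; have [Np hp] := Hp 1%N.
exists Np => N hN z lz; have [z0 hz] := large_le hN lz.
have [x hx ->] := hp z z0 hz.
have ux : vunit (1 + x) by apply: vunit1D; apply: (vmax_vle hx).
by rewrite !mulf_neq0 ?iota_neq0 ?expf_neq0 // (vunit_neq0 ux).
Qed.

(** The powers of z and the factors 1 + x are m-th powers, so the quotient has the class of a / b,
    independent of z. *)
Lemma large_power m p q : (1 < m)%N -> p != 0 -> q != 0 ->
  exists N0, forall N, (N0 <= N)%N -> forall z z', large N z -> large N z' ->
    is_power m (ev_at z p / ev_at z q) -> is_power m (ev_at z' p / ev_at z' q).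
Proof.
move=> m1 /asymptotics[a [i [a0 Hp]]] /asymptotics[b [j [b0 Hq]]].
have [k hk] := @is_power_1D m ltac:(lia).
have [Np hp] := Hp k.+1; have [Nq hq] := Hq k.+1.
exists (Np + Nq + m)%N => N hN z z' lz lz'.
have E u : large N u ->
    is_power m (ev_at u p / ev_at u q) <-> is_power m (iota a / iota b).
  move=> lu; have [u0 hu] := @large_le Np N _ ltac:(lia) lu.
  have [_ hu'] := @large_le Nq N _ ltac:(lia) lu.
  have [x hx ->] := hp u u0 hu; have [x' hx' ->] := hq u u0 hu'.
  have le t : vle (y ^+ k.+1) t -> vunit (1 + t) /\ is_power m (1 + t).
    move=> ht; split; first by apply: vunit1D; apply: (vmax_vle ht); exact: vmaxX.
    by apply: hk; apply: vle_trans ht; exact: vle_expl.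
  have [ux px] := le _ hx; have [ux' px'] := le _ hx'.
  have pu : is_power m u.
    by case: lu => _ _ [w ->]; apply: is_power_fact; lia.
  have -> : iota a * u ^+ i * (1 + x) / (iota b * u ^+ j * (1 + x')) =
     iota a / iota b * (u ^+ i / u ^+ j * ((1 + x) / (1 + x'))).
    by field; rewrite ?(vunit_neq0 ux') ?iota_neq0 ?expf_neq0.
  apply: is_powerMr.
    by rewrite !mulf_neq0 ?invr_eq0 ?expf_neq0 // ?(vunit_neq0 ux) ?(vunit_neq0 ux').
  by apply: is_powerM; apply: is_powerM => //; try apply: is_powerV => //; exact: is_powerX.
by move/(E _ lz)/(E _ lz').
Qed.

(** The thresholds of the three previous lemmas depend on the subterms of [phi]; an ultrafilter on
    the indices N containing all final segments makes them one. *)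
Lemma large_transfer n (phi : formula LMacD n) (x : 'I_n -> {poly R0}) N1 : quantifier_free phi ->
  exists2 N, (N1 <= N)%N & forall z z', large N z -> large N z' ->
    sat (M := M) phi (fun i => ev_at z (x i)) -> sat (M := M) phi (fun i => ev_at z' (x i)).
Proof.
move=> qf.
have [U [ultraU FU]] := ultraFilterLemma eventually_filter.
have ev A : (exists N0, forall N, (N0 <= N)%N -> A N) -> U A.
  by move=> [N0 h]; apply: FU; exists N0.
have FU' : ProperFilter U by exact: ultra_proper.
have T := @transfer_qf K G v nat K U large ultraU {poly R0} ev_at _ _ _ n phi x qf.
have h1 : U [set N | (N1 <= N)%N] by apply: ev; exists N1.
have h2 : U [set N | forall z z', large N z -> large N z' ->
    sat (M := M) phi (fun i => ev_at z (x i)) -> sat (M := M) phi (fun i => ev_at z' (x i))].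
  apply: T.
  - by move=> p p0; apply: ev; exact: large_neq0.
  - by move=> p q p0 q0; apply: ev; exact: large_vle.
  - by move=> m p q m1 p0 q0; apply: ev; exact: large_power.
have [N [hN hT]] := filter_ex (filterI h1 h2).
by exists N.
Qed.

End Asymptotics.

End Approximation.

Section PolyOf.
Variables (K : fieldType) (G : orderedAbelianGroupType) (v : valuation K G).
Implicit Types (x : K).

Definition poly_of n (c : 'I_n -> K) : {poly K} := \sum_(i < n) (c i)%:P * 'X^i.

Lemma poly_ofE n (c : 'I_n -> K) x : (poly_of c).[x] = \sum_(i < n) c i * x ^+ i.
Proof.
by rewrite /poly_of horner_sum; apply: eq_bigr => i _; rewrite hornerM hornerC hornerXn.
Qed.

Lemma deriv_poly_ofE n (c : 'I_n -> K) x :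
  (poly_of c)^`().[x] = \sum_(i < n) c i * (i%:R * x ^+ i.-1).
Proof.
rewrite /poly_of (big_morph _ (@derivD K) (@deriv0 K)) horner_sum; apply: eq_bigr => i _.
by rewrite derivM derivC mul0r add0r derivXn hornerM hornerC hornerMn hornerXn mulr_natl.
Qed.

Lemma poly_of_coef n (f : {poly K}) : (size f <= n)%N -> poly_of (fun i : 'I_n => f`_i) = f.
Proof.
move=> sf; rewrite -[RHS]coefK /poly_of poly_def.
rewrite (big_ord_widen _ (fun i => f`_i *: 'X^i) sf) [RHS]big_mkcond.
apply: eq_bigr => i _; rewrite mul_polyC; case: ltnP => // h.
by rewrite nth_default // scale0r.
Qed.

Lemma coef_poly_of n (c : 'I_n -> K) (i : 'I_n) : (poly_of c)`_i = c i.
Proof.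
rewrite /poly_of coef_sum (bigD1 i) //= coefCM coefXn eqxx mulr1 big1 ?addr0 // => j ji.
by rewrite coefCM coefXn eq_sym val_eqE (negPf ji) mulr0.
Qed.

Lemma size_poly_of n (c : 'I_n -> K) : (size (poly_of c) <= n)%N.
Proof.
apply: (leq_trans (size_sum _ _ _)); apply/bigmax_leqP => i _.
by rewrite mul_polyC (leq_trans (size_scale_leq _ _)) // size_polyXn.
Qed.

Lemma vpoly_of n (c : 'I_n -> K) : (forall i, val_integral v (c i)) -> vpoly v (poly_of c).
Proof.
move=> hc i; rewrite /poly_of coef_sum; elim/big_ind: _ => [||j _].
- exact: vint0.
- exact: vintD.
- by rewrite coefCM; apply: vintM => //; rewrite coefXn; exact: vint_nat.
Qed.

Lemma termfun_poly_of n m (c : 'I_n -> ('I_m -> K) -> K) (x : ('I_m -> K) -> K) :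
  (forall i, termfun v (c i)) -> termfun v x ->
  termfun v (fun e => (poly_of (fun i => c i e)).[x e]).
Proof.
move=> hc hx; have [|t ht] := @termfun_sum _ _ v m _ (enum 'I_n) (fun i e => c i e * x e ^+ i).
  by move=> i; apply: termfunM => //; exact: termfunX.
by exists t => e; rewrite ht poly_ofE big_enum.
Qed.

Lemma termfun_deriv_poly_of n m (c : 'I_n -> ('I_m -> K) -> K) (x : ('I_m -> K) -> K) :
  (forall i, termfun v (c i)) -> termfun v x ->
  termfun v (fun e => (poly_of (fun i => c i e))^`().[x e]).
Proof.
move=> hc hx; have [|t ht] :=
  @termfun_sum _ _ v m _ (enum 'I_n) (fun i e => c i e * (i%:R * x e ^+ i.-1)).
  move=> i; apply: termfunM => //; apply: termfunM; [exact: termfun_nat|exact: termfunX].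
by exists t => e; rewrite ht deriv_poly_ofE big_enum.
Qed.

(** The coefficients are quantified rather than kept as parameters, so that the quantifier-free
    equivalent involves y and z only. *)
Definition approx_roots y z n := forall c : 'I_n -> K, (forall i, val_integral v (c i)) ->
  val_le v y (poly_of c).[0] -> ~ val_small v (poly_of c)^`().[0] ->
  exists x, val_small v x /\ val_le v z (poly_of c).[x].

Lemma definable_approx_roots n :
  definable v (fun e : 'I_2 -> K => approx_roots (e ord0) (e ord_max) n).
Proof.
pose c (E : 'I_(n + 2) -> K) (i : 'I_n) := E (lshift 2 i).
pose S E := (forall i : 'I_n, val_integral v (c E i)) ->
  val_le v (E (rshift n ord0)) (poly_of (c E)).[0] ->
  ~ val_small v (poly_of (c E))^`().[0] ->
  exists x, val_small v x /\ val_le v (E (rshift n ord_max)) (poly_of (c E)).[x].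
have hS : definable v S.
  apply: definable_imp.
    by apply: definable_all_ord => i; apply: definable_vint; exact: termfun_var.
  apply: definable_imp.
    apply: definable_vle; first exact: termfun_var.
    apply: termfun_poly_of; last exact: termfun0.
    by move=> i; exact: termfun_var.
  apply: definable_imp.
    apply: definable_not; apply: definable_vmax.
    apply: termfun_deriv_poly_of; last exact: termfun0.
    by move=> i; exact: termfun_var.
  pose S1 (E : 'I_(n + 2).+1 -> K) := val_small v (E ord0) /\
    val_le v (E (lift ord0 (rshift n ord_max)))
      (poly_of (fun i : 'I_n => E (lift ord0 (lshift 2 i)))).[E ord0].
  have hS1 : definable v S1.
    apply: definable_and; first by apply: definable_vmax; exact: termfun_var.
    apply: definable_vle; first exact: termfun_var.
    by apply: termfun_poly_of => [i|]; exact: termfun_var.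
  apply: (definable_ext _ (definable_ex hS1)) => E.
  have EE x : S1 (extend x E) <-> val_small v x /\ val_le v (E (rshift n ord_max)) (poly_of (c E)).[x].
    rewrite /S1 extend0 extend_lift; have -> // : (fun i : 'I_n => extend x E (lift ord0 (lshift 2 i))) = c E.
    by apply/funext => i; rewrite extend_lift.
  by split=> -[x hx]; exists x; apply/EE.
apply: (definable_ext _ (definable_all_block hS)) => e.
have E d : c (cat_env d e) = d by apply/funext => i; rewrite /c cat_envl.
by split=> h d; have := h d; rewrite /S E !cat_envr.
Qed.

End PolyOf.

Section Approximation.
Variables (K : fieldType) (G : orderedAbelianGroupType) (v : valuation K G).
Hypothesis char0 : [pchar K] =i pred0.
Hypothesis qe : admits_QE (Th (mac_structure v)).
Hypothesis hpow : forall n x, val_small v x -> is_power n (1 + n%:R ^+ 2 * x).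
Local Notation M := (mac_structure v).
Local Notation vle := (val_le v).
Local Notation vmax := (val_small v).
Local Notation vint := (val_integral v).
Local Notation vunit := (val_unit v).

Lemma vle_expr_self x n : vint x -> (0 < n)%N -> vle x (x ^+ n).
Proof. by move=> hx n0; rewrite -[X in val_le _ X]expr1; exact: vle_expl. Qed.

(* By Newton iteration [approx_roots y z n] holds when z is a power of y; for
   N large all the N!-th powers z divisible by y^N satisfy the same
   quantifier-free formulas over y. *)
Lemma qe_approx_roots (R0 : idomainType) (iota : {rmorphism R0 -> K}) (y0 : R0) z n :
  vmax (iota y0) -> iota y0 != 0 -> (forall a, vint (iota a)) ->
  (forall a, a != 0 -> exists N, vle (iota a) (iota y0 ^+ N)) ->
  z != 0 -> approx_roots v (iota y0) z n.
Proof.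
move=> ymax y_neq0 iint arch z0.
have yint := vmax_vint ymax.
(* For z outside O, approximation up to z = 1 is stronger. *)
wlog zint : z z0 / vint z.
  move=> H; case/orP: (vle_total v 1 z) => [/H|z1]; first exact.
  have /H/(_ (vint1 v)) H1 : 1 != 0 :> K by exact: oner_neq0.
  move=> c h1 h2 h3; have [x [hx hx']] := H1 c h1 h2 h3.
  by exists x; split=> //; apply: vle_trans hx'.
have [psi qf hpsi] := qe_definable qe (definable_approx_roots v n).
have [N _ H] := @large_transfer K G v char0 hpow R0 iota y0 ymax y_neq0 iint arch 2 psi
  (pair_arg y0%:P 'X) 0 qf.
have E u : (fun i : 'I_2 => ev_at iota u (pair_arg y0%:P 'X i)) = pair_arg (iota y0) u.
  apply/funext => i; rewrite /pair_arg; case: ifP => _.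
    by rewrite ev_atE map_polyC hornerC.
  by rewrite ev_atE map_polyX hornerX.
pose y := iota y0.
have lb : large v iota y0 N ((y ^+ N) ^+ N`!).
  split; first by rewrite !expf_neq0.
    by apply: vle_expr_self; [exact: vintX|exact: fact_gt0].
  by exists (y ^+ N).
have zyint : vint (z * y ^+ N) by apply: vintM => //; exact: vintX.
(* The factor y^N and the exponent N! put the element into [large]; being a multiple of z, it
   demands at least as good an approximation as z does. *)
have lz : large v iota y0 N ((z * y ^+ N) ^+ N`!).
  split; first by rewrite expf_neq0 // mulf_neq0 // expf_neq0.
    apply: vle_trans (vle_expr_self zyint (fact_gt0 _)); rewrite mulrC; apply: vleMint => //.
    exact: vle_refl.
  by exists (z * y ^+ N).
have : approx_roots v y ((z * y ^+ N) ^+ N`!) n.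
  suff : approx_roots v y ((y ^+ N) ^+ N`!) n.
    move=> /(hpsi (pair_arg y ((y ^+ N) ^+ N`!))); rewrite -E => /(H _ _ lb lz).
    by rewrite E => /hpsi.
  move=> c hc h0 hd; rewrite -exprM.
  have vc := vpoly_of hc.
  have hu : vunit (poly_of c)^`().[0].
    by split=> //; apply: vpoly_horner; [exact: vpoly_deriv|exact: vint0].
  have [x hx hx'] := newton (N * N`!) vc hu ymax h0.
  by exists x; split=> //; apply: vle_trans hx'; exact: vle_expl.
move=> A c h1 h2 h3; have [x [hx hx']] := A c h1 h2 h3; exists x; split=> //.
apply: vle_trans hx'; apply: vle_trans (vle_expr_self zyint (fact_gt0 _)).
by apply: vleMint; [exact: vintX|exact: vle_refl].
Qed.

End Approximation.

(** * Polynomials without roots *)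

Section Gauss.
Variables (K : fieldType) (G : orderedAbelianGroupType) (v : valuation K G).
Local Notation vle := (val_le v).
Local Notation vmax := (val_small v).
Local Notation vint := (val_integral v).
Local Notation vunit := (val_unit v).
Local Notation vpoly := (vpoly v).
Implicit Types (d e f g : {poly K}).

Lemma min_coef f : f != 0 -> exists i,
  [/\ f`_i != 0, forall j, vle f`_i f`_j & forall j, (j < i)%N -> vmax (f`_j / f`_i)].
Proof.
move=> f0.
have : exists i, `[< forall j, vle f`_i f`_j >].
  suff [i hi] : exists i, forall j, (j < size f)%N -> vle f`_i f`_j.
    exists i; apply/asboolP => j; case: (ltnP j (size f)) => [/hi //|h].
    by rewrite [f`_j]nth_default //; exact: vle0.
  elim: (size f) => [|n [i IH]]; first by exists 0%N.
  case/orP: (vle_total v f`_i f`_n) => h.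
    by exists i => j; rewrite ltnS leq_eqVlt => /orP[/eqP -> //|/IH].
  exists n => j; rewrite ltnS leq_eqVlt => /orP[/eqP ->|/IH h']; first exact: vle_refl.
  exact: vle_trans h h'.
case/ex_minnP => i /asboolP hi imin.
have fi0 : f`_i != 0 by apply: (vle_neq0 (hi (size f).-1)); rewrite -lead_coefE lead_coef_eq0.
exists i; split=> // j ji; apply/negP => h.
have : (i <= j)%N.
  apply: imin; apply/asboolP => k; apply: vle_trans (hi k).
  by rewrite -(@vleMr _ _ _ (f`_i)^-1) ?invr_eq0 // mulfV.
by rewrite leqNgt ji.
Qed.

(* The product of the first coefficients of least value of d and e dominates
   the corresponding coefficient of d * e. *)
Lemma gauss d e : d \is monic -> e \is monic -> vpoly (d * e) -> vpoly d.
Proof.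
move=> md me hde.
have [i [di0 di hi]] := min_coef (monic_neq0 md).
have [j [ej0 ej hj]] := min_coef (monic_neq0 me).
have := hde (i + j)%N; rewrite coefM.
have ij : (i < (i + j).+1)%N by lia.
rewrite (bigD1 (Ordinal ij)) //= addKn.
set s := \sum_(_ | _) _.
have hs : vmax (s / (d`_i * e`_j)).
  rewrite /s mulr_suml; elim/big_ind: _ => [||k kij]; [exact: vmax0|exact: vmaxD|].
  have -> : d`_k * e`_(i + j - k) / (d`_i * e`_j) = d`_k / d`_i * (e`_(i + j - k) / e`_j).
    by field; rewrite di0 ej0.
  have {}kij : (k : nat) != i by apply: contraNneq kij => h; apply/eqP; exact: val_inj.
  case: (ltnP k i) => ki.
    by apply: vmaxMr; [apply/vint_div|exact: hi].
  apply: vmaxMl; first by apply/vint_div.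
  by apply: hj; move/eqP: kij; case: k ki => k /=; lia.
have -> : d`_i * e`_j + s = d`_i * e`_j * (1 + s / (d`_i * e`_j)).
  by field; rewrite di0 ej0.
rewrite /val_integral vle_unitMr; last exact: vunit1D.
move=> h k; apply: vle_trans (di k); apply: (vle_trans h).
rewrite -[X in val_le _ _ X]mulr1; apply: vleM.
by have := ej (size e).-1; rewrite -lead_coefE (monicP me).
Qed.

(** A failure of Hensel's lemma, translated to the residual root 0. Being monic, f corresponds to a
    point of K^n, and its monic factors are integral. *)
Definition bad n f := [/\ f \is monic, size f = n.+1, vpoly f, vmax f.[0] &
  vunit f^`().[0] /\ forall x, vmax x -> f.[x] != 0].

Lemma bad_size n f : bad n f -> (1 < n)%N.
Proof.
case: n => [|[|n]] // [mf sf vf f0 [_ nr]].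
  have /size_poly1P[c _ e] : size f == 1%N by rewrite sf.
  by move: f0 (monicP mf); rewrite e hornerC lead_coefC => h c1; rewrite c1 /val_small vle_refl in h.
have e : f = 'X + (f`_0)%:P.
  apply/polyP => i; rewrite coefD coefX coefC; case: i => [|[|i]] /=; rewrite ?add0r //.
    by rewrite addr0; move: (monicP mf); rewrite /lead_coef sf.
  by rewrite nth_default // sf.
have h0 : vmax f`_0 by move: f0; rewrite horner_coef0.
have := nr _ (vmaxN h0); rewrite [X in X.[_]]e !hornerE addNr eqxx //.
Qed.

(** In a factorization f = d e into monic polynomials, integral by [gauss], one factor takes a value
    in M at 0, say d. As f'(0) = d'(0) e(0) + d(0) e'(0) is a unit, so is d'(0), and d is bad of
    smaller degree. *)
Lemma bad_irreducible n f : (forall m g, (m < n)%N -> ~ bad m g) -> bad n f ->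
  irreducible_poly f.
Proof.
move=> Hn hf; have n1 := bad_size hf; case: hf => mf sf vf f0 [f'0 nr].
have f_neq0 := monic_neq0 mf.
have aux d e : d \is monic -> e \is monic -> f = d * e -> (1 < size d < n.+1)%N ->
    vmax d.[0] -> False.
  move=> md me E sd d0.
  have vd : vpoly d by apply: (gauss md me); rewrite -E.
  have ve : vpoly e by apply: (gauss me md); rewrite mulrC -E.
  apply: (Hn (size d).-1 d); first by lia.
  split=> //; first by rewrite prednK //; lia.
  split; last first.
    by move=> x /nr; rewrite E hornerM mulf_eq0 negb_or => /andP[].
  have vd' := vpoly_horner (vpoly_deriv vd) (vint0 v).
  have ve0 := vpoly_horner ve (vint0 v).
  apply: (vunitMl vd' ve0).
  move: f'0; rewrite E derivM hornerD !hornerM => h.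
  rewrite -[X in vunit X](addrK (d.[0] * e^`().[0])); apply: vunitD => //.
  apply: vmaxN; apply: vmaxMr => //.
  exact: vpoly_horner (vpoly_deriv ve) (vint0 v).
split; first by rewrite sf; lia.
move=> q sq1 qf.
have q0 : q != 0 by apply: contraTneq qf => ->; rewrite dvd0p.
case: (ltnP (size q) (size f)) => sqf; last first.
  by rewrite -(dvdp_size_eqp qf) eqn_leq (dvdp_leq f_neq0 qf).
exfalso; have /dvdpP[r E] := qf.
have r0 : r != 0 by apply: contraNneq f_neq0 => r0; rewrite E r0 mul0r.
have lq0 : lead_coef q != 0 by rewrite lead_coef_eq0.
pose q1 := (lead_coef q)^-1 *: q; pose r1 := lead_coef q *: r.
have E1 : f = r1 * q1 by rewrite /r1 /q1 -scalerAl -scalerAr scalerA mulfV // scale1r.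
have mq : q1 \is monic by rewrite monicE lead_coefZ mulVf.
have mr : r1 \is monic.
  by move: mf; rewrite E1 !monicE lead_coefM (monicP mq) mulr1.
have sq : size q1 = size q by rewrite size_scale // invr_eq0.
have sf' : size f = (size r1 + size q).-1 by rewrite E1 size_monicM ?monic_neq0 // sq.
have sq0 : (0 < size q)%N by rewrite size_poly_gt0.
have vr : vpoly r1 by apply: (gauss mr mq); rewrite -E1.
have vq : vpoly q1 by apply: (gauss mq mr); rewrite mulrC -E1.
have L (a b c : nat) : b != 1%N -> (0 < b)%N -> c = (a + b).-1 -> c = n.+1 -> (b < c)%N ->
    (1 < a < n.+1)%N /\ (1 < b < n.+1)%N by lia.
have [sr1 sq1'] := L _ _ _ sq1 sq0 sf' sf sqf.
have := f0; rewrite {1}E1 hornerM => h.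
case: (vmax_prime _ _ h); try exact: vpoly_horner (vint0 v).
  exact: (aux r1 q1).
by apply: (aux q1 r1) => //; [rewrite mulrC|rewrite sq].
Qed.

End Gauss.

(** * Deformations of irreducible polynomials *)

Lemma deriv_sum (R : nzRingType) (I : Type) (r : seq I) (P : pred I) (F : I -> {poly R}) :
  (\sum_(i <- r | P i) F i)^`() = \sum_(i <- r | P i) (F i)^`().
Proof. exact: (big_morph _ (@derivD R) (@deriv0 R)). Qed.

Section Deformation.
Variables (K : fieldType) (m : nat).
Local Notation n := m.+1.

(** Matrices over K[s] matter only to first order at s = 0; [mx_deriv0] is the other half of this
    data. *)
Definition mx_at0 (B : 'M[{poly K}]_n) : 'M[K]_n := map_mx (horner_eval 0) B.
Definition mx_deriv0 (B : 'M[{poly K}]_n) : 'M[K]_n :=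
  \matrix_(i, j) (B i j)^`().[0].

Lemma mx_at0M B C : mx_at0 (B * C) = mx_at0 B * mx_at0 C.
Proof. exact: map_mxM. Qed.

Lemma mx_at0X B i : mx_at0 (B ^+ i) = mx_at0 B ^+ i.
Proof.
elim: i => [|i IH]; first by rewrite !expr0 /mx_at0 map_mx1.
by rewrite !exprS mx_at0M IH.
Qed.

Lemma mx_deriv0D B C : mx_deriv0 (B + C) = mx_deriv0 B + mx_deriv0 C.
Proof. by apply/matrixP => i j; rewrite !mxE derivD hornerD. Qed.

Lemma mx_deriv0_sum (I : Type) (r : seq I) (F : I -> 'M[{poly K}]_n) :
  mx_deriv0 (\sum_(i <- r) F i) = \sum_(i <- r) mx_deriv0 (F i).
Proof.
apply: (big_morph _ mx_deriv0D); apply/matrixP => i j.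
by rewrite !mxE deriv0 horner0.
Qed.

Lemma mx_deriv0M B C :
  mx_deriv0 (B * C) = mx_deriv0 B * mx_at0 C + mx_at0 B * mx_deriv0 C.
Proof.
apply/matrixP => i j; rewrite !mxE -big_split /= deriv_sum horner_sum.
apply: eq_bigr => k _; rewrite !mxE derivM hornerD !hornerM.
by rewrite /horner_eval.
Qed.

Lemma mx_deriv0Z (p : {poly K}) B :
  mx_deriv0 (p *: B) = p^`().[0] *: mx_at0 B + p.[0] *: mx_deriv0 B.
Proof. by apply/matrixP => i j; rewrite !mxE derivM hornerD !hornerM. Qed.

Lemma horner_mx_sum (R : comNzRingType) (B : 'M[R]_n) (p : {poly R}) :
  horner_mx B p = \sum_(i < size p) p`_i *: B ^+ i.
Proof.
rewrite -[in LHS](coefK p) poly_def rmorph_sum /=; apply: eq_bigr => i _.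
by rewrite linearZ /= rmorphXn /= horner_mx_X.
Qed.

Variable (g : {poly K}).
Hypothesis g_monic : g \is monic.
Hypothesis g_size : size g = n.+1.
Hypothesis g_irr : irreducible_poly g.
Hypothesis g_sep : g^`() != 0.

Lemma exists_companion : exists A : 'M[K]_n, char_poly A = g.
Proof.
have := companionmxK g_monic; move: (companionmx g); rewrite g_size => A hA.
by exists A.
Qed.

Variable A : 'M[K]_n.
Hypothesis A_char : char_poly A = g.

Lemma horner_mx_char : horner_mx A g = 0.
Proof. by rewrite -A_char Cayley_Hamilton. Qed.

Lemma horner_mx_inv (u : {poly K}) : u != 0 -> (size u < size g)%N ->
  exists w, horner_mx A w * horner_mx A u = 1.
Proof.
move=> u0 su; have : coprimep g u.
  rewrite irreducible_poly_coprime //; apply/negP => /(dvdp_leq u0).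
  by rewrite leqNgt su.
case/Bezout_eq1_coprimepP => -[a w] /= e; exists w.
by rewrite -rmorphM -[w * u](addKr (a * g)) e rmorphD rmorphN rmorphM /= horner_mx_char mulr0 oppr0 add0r rmorph1.
Qed.

Lemma horner_mx_inj (u w : {poly K}) : (size u < size g)%N -> (size w < size g)%N ->
  horner_mx A u = horner_mx A w -> u = w.
Proof.
move=> su sw e; apply/eqP; rewrite -subr_eq0; apply: contraT => uw0.
have [|z] := horner_mx_inv uw0.
  by apply: leq_ltn_trans (size_polyD _ _) _; rewrite size_polyN gtn_max su sw.
by rewrite rmorphB /= e subrr mulr0 => /esym/eqP; rewrite oner_eq0.
Qed.

(** A root x would be an eigenvalue of u(A), but u(A) - x is a nonzero element of the field K[A],
    hence invertible. *)
Lemma char_poly_noroot (u : {poly K}) x : (1 < size u <= n)%N ->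
  (char_poly (horner_mx A u)).[x] != 0.
Proof.
move=> su; apply/negP => /eqP/rootP; rewrite -eigenvalue_root_char => /eigenvalueP[r hr r0].
have ux : u - x%:P != 0.
  by rewrite subr_eq0; apply: contraTneq su => ->; rewrite size_polyC; case: eqP.
have [|z hz] := horner_mx_inv ux.
  apply: leq_ltn_trans (size_polyD _ _) _; rewrite size_polyN gtn_max g_size size_polyC.
  by case: eqP => _; lia.
have c : horner_mx A z * horner_mx A (u - x%:P) = horner_mx A (u - x%:P) * horner_mx A z.
  by rewrite -!rmorphM mulrC.
have : r *m (horner_mx A (u - x%:P) * horner_mx A z) = 0.
  rewrite mulmxA rmorphB /= horner_mx_C mulmxBr hr mul_mx_scalar subrr.
  exact: mul0mx.
rewrite -c hz => /eqP; rewrite [r *m 1]mulmx1 (negPf r0) //.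
Qed.

(* By Cayley-Hamilton, the derivative of char_poly (A + s W) at s = 0 is the
   polynomial r with r(A) = - W g'(A); since g' is invertible modulo g, every
   r of degree less than n arises in this way. *)
Lemma char_poly_deformation (j : 'I_n) : exists (H : 'I_n -> {poly K}) (w : {poly K}),
  [/\ forall i, (H i).[0] = g`_i, forall i, (H i)^`().[0] = (i == j)%:R &
      forall s x, 1 + s * w`_1 != 0 -> (1 < n)%N ->
        x ^+ n + \sum_(i < n) (H i).[s] * x ^+ i != 0].
Proof.
have [|z hz] := horner_mx_inv g_sep; first by rewrite lt_size_deriv // monic_neq0.
(* As z inverts g' modulo g, this is the solution of - w g' = X^j modulo g. *)
pose w := (- (z * 'X^j)) %% g.
pose W := horner_mx A w.
have WE : W = - (horner_mx A z * A ^+ j).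
  have -> : W = horner_mx A (- (z * 'X^j)).
    by rewrite [in RHS](divp_eq (- (z * 'X^j)) g) rmorphD rmorphM /= horner_mx_char mulr0 add0r.
  by rewrite rmorphN rmorphM rmorphXn /= horner_mx_X.
have sw : (size w < size g)%N by rewrite ltn_modp monic_neq0.
pose B : 'M[{poly K}]_n := map_mx polyC A + 'X *: map_mx polyC W.
pose C := char_poly B.
have Cs s : map_poly (horner_eval s) C = char_poly (horner_mx A ('X + s *: w)).
  have -> : horner_mx A ('X + s *: w) = A + s *: W.
    by rewrite rmorphD /= horner_mx_X linearZ.
  rewrite map_char_poly; congr char_poly; apply/matrixP => a b.
  rewrite /B !mxE /= /horner_eval.
  by rewrite hornerD hornerM hornerX !hornerC.
have sC : size C = n.+1 by rewrite size_char_poly.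
have Cn : C`_n = 1 by have := monicP (char_poly_monic B); rewrite /lead_coef size_char_poly.
have C0 i : (C`_i).[0] = g`_i.
  have := congr1 (fun p : {poly K} => p`_i) (Cs 0); rewrite coef_map /= /horner_eval => ->.
  by rewrite scale0r addr0 horner_mx_X A_char.
have B0 : mx_at0 B = A.
  by apply/matrixP => a b; rewrite /B !mxE /= /horner_eval hornerD hornerM hornerX !hornerC mul0r addr0.
have B1 : mx_deriv0 B = W.
  apply/matrixP => a b.
  by rewrite /B !mxE derivD derivM derivX !derivC mulr0 addr0 add0r mul1r hornerC.
have cAW i : A ^+ i * W = W * A ^+ i.
  by rewrite /W -[X in X ^+ i](horner_mx_X A) -rmorphXn -!rmorphM mulrC.
have BX i : mx_deriv0 (B ^+ i) = W * A ^+ i.-1 *+ i.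
  elim: i => [|i IH].
    by rewrite expr0 mulr0n; apply/matrixP => a b; rewrite !mxE derivMn -[1]/(1%:P) derivC mul0rn horner0.
  rewrite exprSr mx_deriv0M IH mx_at0X B0 B1 cAW mulrSr; congr (_ + _).
  case: i {IH} => [|i]; first by rewrite mulr0n mul0r.
  by rewrite mulrnAl -mulrA -exprSr.
(* The derivative of C(B) = 0 at s = 0 is r(A) + W g'(A) = 0: W commutes with A, and the constant
   leading coefficient of C adds nothing to r. *)
have : mx_deriv0 (horner_mx B C) = 0.
  by rewrite Cayley_Hamilton; apply/matrixP => a b; rewrite !mxE deriv0 horner0.
pose r := \sum_(i < n) (C`_i)^`().[0] *: 'X^i.
have rA : horner_mx A r = \sum_(i < n) (C`_i)^`().[0] *: A ^+ i.
  by rewrite rmorph_sum /=; apply: eq_bigr => i _; rewrite linearZ /= rmorphXn /= horner_mx_X.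
have gA : horner_mx A g^`() = \sum_(i < n.+1) g`_i *: (A ^+ i.-1 *+ i).
  rewrite -[X in X^`()]coefK poly_def g_size deriv_sum rmorph_sum /=; apply: eq_bigr => i _.
  by rewrite derivZ linearZ /= derivXn rmorphMn /= rmorphXn /= horner_mx_X.
rewrite horner_mx_sum sC mx_deriv0_sum.
under eq_bigr => i _ do rewrite mx_deriv0Z C0 mx_at0X B0 BX.
rewrite big_split /= big_ord_recr /= Cn -[1]/(1%:P) derivC horner0 scale0r addr0 -rA.
have -> : \sum_(i < n.+1) g`_i *: (W * A ^+ i.-1 *+ i) = W * horner_mx A g^`().
  rewrite gA mulr_sumr; apply: eq_bigr => i _.
  by rewrite -scalerAr -mulrnAr.
rewrite WE mulNr -mulrA.
have -> : A ^+ j * horner_mx A g^`() = horner_mx A g^`() * A ^+ j.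
  by rewrite -[X in X ^+ j](horner_mx_X A) -rmorphXn -!rmorphM mulrC.
rewrite mulrA hz mul1r => /eqP; rewrite subr_eq0 => /eqP e.
have {}e : r = 'X^j.
  apply: horner_mx_inj.
  - rewrite g_size; apply: (leq_ltn_trans (size_sum _ _ _)); rewrite ltnS; apply/bigmax_leqP => i _.
    by rewrite (leq_trans (size_scale_leq _ _)) // size_polyXn.
  - by rewrite size_polyXn g_size ltnS.
  - by rewrite e rmorphXn /= horner_mx_X.
exists (fun i => C`_i), w; split=> [i|i|s x s0 n1]; first exact: C0.
  have := congr1 (fun p : {poly K} => p`_i) e; rewrite coefXn.
  rewrite /r coef_sum (bigD1 i) //= coefZ coefXn eqxx mulr1 big1 ?addr0 // => k ki.
  by rewrite coefZ coefXn eq_sym val_eqE (negPf ki) mulr0.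
have := @char_poly_noroot ('X + s *: w) x.
rewrite -Cs horner_coef size_map_poly_id0; last first.
  by rewrite (monicP (char_poly_monic B)) rmorph1 oner_neq0.
rewrite sC big_ord_recr /= coef_map Cn -[X in X * x ^+ n]/((1%:P : {poly K}).[s]) hornerC mul1r addrC => h.
under eq_bigr => i _ do rewrite -[(C`_i).[s]]/(horner_eval s C`_i) -coef_map.
(* The coefficient of X in X + s w is 1 + s w_1; where it is nonzero, X + s w is not constant. *)
apply: h; apply/andP; split.
  rewrite ltnNge; apply/negP => /size1_polyC/(congr1 (fun p : {poly K} => p`_1)).
  by rewrite coefC coefD coefX coefZ /= => /eqP; rewrite (negPf s0).
apply: (leq_trans (size_polyD _ _)); rewrite geq_max size_polyX n1.
by apply: (leq_trans (size_scale_leq _ _)); rewrite -ltnS -g_size.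
Qed.

End Deformation.

(** * Zariski density *)

Lemma mpoly_ring_ind (R : comNzRingType) n (P : {mpoly R[n]} -> Prop) :
  (forall c, P c%:MP) -> (forall i, P 'X_i) ->
  (forall p q, P p -> P q -> P (p + q)) -> (forall p q, P p -> P q -> P (p * q)) ->
  forall p, P p.
Proof.
move=> PC PX PD PM p; elim/mpolyind: p => [|c m p _ _ IH].
  by rewrite -mpolyC0.
apply: PD => //; rewrite -mul_mpolyC; apply: (PM) => //.
rewrite mpolyXE_id; elim/big_ind: _ => [||i _]; [by rewrite -mpolyC1|exact: PM|].
by elim: (m i) => [|k IHk]; [rewrite expr0 -mpolyC1|rewrite exprS; exact: PM].
Qed.

Section Curves.
Variables (K : fieldType) (n : nat) (H : 'I_n -> {poly K}).
Implicit Types (Q : {mpoly K[n]}).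

(** The restriction of Q to the polynomial curve s |-> (H i (s))_i. *)
Definition along Q : {poly K} := mmap (@polyC K) H Q.

Lemma alongC c : along c%:MP = c%:P. Proof. exact: mmapC. Qed.
Lemma alongX i : along 'X_i = H i. Proof. by rewrite /along mmapX mmap1U. Qed.
Lemma alongD p q : along (p + q) = along p + along q. Proof. exact: rmorphD. Qed.
Lemma alongM p q : along (p * q) = along p * along q. Proof. exact: rmorphM. Qed.

Lemma horner_along s Q : (along Q).[s] = Q.@[fun i => (H i).[s]].
Proof.
elim/mpoly_ring_ind: Q => [c|i|p q hp hq|p q hp hq].
- by rewrite alongC hornerC mevalC.
- by rewrite alongX mevalXU.
- by rewrite alongD hornerD mevalD hp hq.
- by rewrite alongM hornerM mevalM hp hq.
Qed.

Lemma deriv_along Q : (along Q)^`() = \sum_(i < n) along Q^`M(i) * (H i)^`().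
Proof.
elim/mpoly_ring_ind: Q => [c|j|p q hp hq|p q hp hq].
- rewrite alongC derivC big1 // => i _.
  by rewrite mderivC -mpolyC0 alongC mul0r.
- rewrite alongX (bigD1 j) //= mderivX mnm1E eqxx scale1r big1 ?addr0.
    by rewrite (_ : (U_(j) - U_(j))%MM = 0%MM) ?mpolyX0 -?mpolyC1 ?alongC ?mul1r //; apply/mnmP => i; rewrite mnmBE subnn mnm0E.
  move=> i ij; rewrite mderivX mnm1E eq_sym (negPf ij) scale0r.
  by rewrite -mpolyC0 alongC mul0r.
- rewrite alongD derivD hp hq -big_split; apply: eq_bigr => i _.
  by rewrite mderivD alongD mulrDl.
- rewrite alongM derivM hp hq mulr_suml mulr_sumr -big_split; apply: eq_bigr => i _ /=.
  rewrite mderivM alongD !alongM; ring.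
Qed.

End Curves.

(* A polynomial is determined up to a constant by its partial derivatives, so
   a set closed under small motions in every coordinate direction, to first
   order, is Zariski dense. *)
Lemma mpoly_eq0_deform (K : fieldType) n (T : ('I_n -> K) -> Prop) :
  [pchar K] =i pred0 -> (exists c, T c) ->
  (forall c j, T c -> exists H : 'I_n -> {poly K},
    [/\ forall i, (H i).[0] = c i, forall i, (H i)^`().[0] = (i == j)%:R &
        forall p : {poly K}, (forall s, T (fun i => (H i).[s]) -> p.[s] = 0) -> p = 0]) ->
  forall Q : {mpoly K[n]}, (forall c, T c -> Q.@[c] = 0) -> Q = 0.
Proof.
move=> /pcharf0P char0 [c0 Tc0] hT Q.
have [d hd] : exists d, forall m : 'X_{1..n}, (d <= mdeg m)%N -> Q@_m = 0.
  by exists (msize Q) => m /msize_mdeg_ge/memN_msupp_eq0.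
elim: d Q hd => [|d IH] Q hd QT.
  by apply/mpolyP => m; rewrite hd // mcoeff0.
have dQ j : Q^`M(j) = 0.
  apply: IH => [m hm|c Tc].
    by rewrite mcoeff_deriv hd ?mul0rn // mdegD mdeg1 addn1 ltnS.
  have [H [H0 H1 hp]] := hT c j Tc.
  have e : along H Q = 0 by apply: hp => s Ts; rewrite horner_along QT.
  have := deriv_along H Q; rewrite e deriv0 => /(congr1 (fun p : {poly K} => p.[0])).
  rewrite horner0 horner_sum (bigD1 j) //= big1 => [|i ij]; last first.
    by rewrite hornerM H1 (negPf ij) mulr0.
  rewrite addr0 hornerM H1 eqxx mulr1 horner_along => /esym.
  by have -> : (fun i => (H i).[0]) = c by apply/funext.
(* In characteristic 0 a monomial containing the i-th variable survives the i-th partial derivative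
   up to a nonzero factor. *)
have Qm m : m != 0%MM -> Q@_m = 0.
  move=> m0; have [i mi] : exists i, m i != 0%N.
    apply: contrapT => /forallNP h; move/eqP: m0; apply; apply/mnmP => i.
    by rewrite mnm0E; apply/eqP; apply: contrapT => /negP; exact: h.
  have := congr1 (fun p => p@_(m - U_(i))) (dQ i); rewrite mcoeff_deriv mcoeff0.
  rewrite submK; last by apply/mnm_lepP => k; rewrite mnm1E; case: eqP => // <-; rewrite lt0n.
  by move/eqP; rewrite -mulr_natr mulf_eq0 char0 orbF => /eqP.
have QC : Q = (Q@_0%MM)%:MP.
  apply/mpolyP => m; rewrite mcoeffC; case: eqP => [<-|/eqP h]; first by rewrite mulr1.
  by rewrite mulr0 Qm // eq_sym.
by have := QT _ Tc0; rewrite QC mevalC => ->; rewrite mpolyC0.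
Qed.

(** * Continuity in the valuation topology *)

Section Continuity.
Variables (K : fieldType) (G : orderedAbelianGroupType) (v : valuation K G).
Local Notation vle := (val_le v).
Local Notation vmax := (val_small v).
Local Notation vint := (val_integral v).
Local Notation vunit := (val_unit v).

Lemma vint_scale (a : K) : exists b, [/\ b != 0, vint b & vint (b * a)].
Proof.
case/orP: (vle_total v 1 a) => h; first by exists 1; rewrite mul1r oner_neq0; split=> //; exact: vint1.
have [a0|a0] := eqVneq a 0.
  by exists 1; rewrite a0 mulr0 oner_neq0; split=> //; [exact: vint1|exact: vint0].
exists a^-1; rewrite mulVf // invr_eq0; split=> //; last exact: vint1.
by rewrite /val_integral -invr1 vleV ?oner_neq0.
Qed.

Lemma vle_bound (a b : K) : a != 0 -> b != 0 -> exists c, [/\ c != 0, vle a c & vle b c].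
Proof.
move=> a0 b0; case/orP: (vle_total v a b) => h; first by exists b; split=> //; exact: vle_refl.
by exists a; split=> //; exact: vle_refl.
Qed.

Lemma vle_bound_fin n (P : 'I_n -> K -> Prop) :
  (forall i a b, vle a b -> P i a -> P i b) -> (forall i, exists2 a, a != 0 & P i a) ->
  exists2 a, a != 0 & forall i, P i a.
Proof.
move=> mono ex.
suff [a a0 h] : exists2 a, a != 0 & forall i, i \in enum 'I_n -> P i a.
  by exists a => // i; apply: h; rewrite mem_enum.
elim: (enum 'I_n) => [|i r [a a0 ha]]; first by exists 1; rewrite ?oner_neq0.
have [b b0 hb] := ex i; have [c [c0 ac bc]] := vle_bound a0 b0.
exists c => // j; rewrite inE => /orP[/eqP ->|/ha h]; [exact: mono bc hb|exact: mono ac h].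
Qed.

Section Cont.
Variables (X : Type) (near : K -> X -> X -> Prop).
Hypothesis near_mono : forall a b x x', vle a b -> near b x x' -> near a x x'.

(** The relation [near] is left abstract to cover functions on K and on K^n at once; radii are
    nonzero elements of K. *)
Definition vcont (f : X -> K) x := forall eta, eta != 0 ->
  exists2 rho, rho != 0 & forall x', near rho x x' -> vle eta (f x' - f x).

Lemma vcont_const c x : vcont (fun=> c) x.
Proof.
by move=> eta _; exists 1; rewrite ?oner_neq0 // => x' _; rewrite subrr; exact: vle0.
Qed.

Lemma vcont_ext f g x : (forall y, g y = f y) -> vcont f x -> vcont g x.
Proof. by move=> /funext ->. Qed.

Lemma vcontD f g x : vcont f x -> vcont g x -> vcont (fun x => f x + g x) x.
Proof.
move=> hf hg eta eta0; have [a a0 ha] := hf _ eta0; have [b b0 hb] := hg _ eta0.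
have [c [c0 ac bc]] := vle_bound a0 b0; exists c => // x' hx.
rewrite opprD addrACA; apply: vle_add; [apply: ha|apply: hb]; exact: near_mono hx.
Qed.

Lemma vcontM f g x : vcont f x -> vcont g x -> vcont (fun x => f x * g x) x.
Proof.
move=> hf hg eta eta0.
have [p [p0 pi pf]] := vint_scale (f x); have [q [q0 qi qg]] := vint_scale (g x).
have [e [e0 _ ee]] : exists e, [/\ e != 0, vle eta e & vle 1 e].
  by apply: vle_bound => //; exact: oner_neq0.
have [e' [e0' ee' ei']] : exists e, [/\ e != 0, vle eta e & vle 1 e].
  by apply: vle_bound => //; exact: oner_neq0.
(* The factors p and q absorb f(x) and g(x), and e' alone is already as small as eta, so all three
   terms of the product expansion are divisible by eta. *)
pose d := e' * p * q.
have d0 : d != 0 by rewrite !mulf_neq0.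
have [a a0 ha] := hf _ d0; have [b b0 hb] := hg _ d0.
have [c [c0 ac bc]] := vle_bound a0 b0; exists c => // x' hx.
have {}ha := ha x' (near_mono ac hx); have {}hb := hb x' (near_mono bc hx).
have -> : f x' * g x' - f x * g x =
   (f x' - f x) * (g x' - g x) + (f x' - f x) * g x + f x * (g x' - g x) by ring.
have dint : vint d by apply: vintM => //; exact: vintM.
have ed : vle eta d.
  by apply: vleMint => //; apply: vleMint.
apply: vle_add; first apply: vle_add.
- apply: vleMint; last exact: vle_trans ed ha.
  exact: vle_trans dint hb.
- apply: (@vle_trans _ _ v (d * g x)); last by apply: vleM2 => //; exact: vle_refl.
  by rewrite /d -mulrA; apply: vleMint => //; apply: vleMint.
- apply: (@vle_trans _ _ v (f x * d)); last exact: vleM.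
  have -> : f x * d = e' * q * (p * f x) by rewrite /d; ring.
  by apply: vleMint => //; apply: vleMint.
Qed.

End Cont.

Lemma poly_vcont (p : {poly K}) x :
  vcont (fun rho x x' => vle rho (x' - x)) (fun y => p.[y]) x.
Proof.
have mono a b (y y' : K) : vle a b -> vle b (y' - y) -> vle a (y' - y) by exact: vle_trans.
elim/poly_ind: p => [|p c IH].
  by apply: (vcont_ext (f := fun=> 0)) (vcont_const _ _ _) => y; rewrite horner0.
apply: (vcont_ext (f := fun y => p.[y] * y + c)).
  by move=> y; rewrite hornerD hornerM hornerX hornerC.
apply: vcontD => //; last exact: vcont_const.
by apply: vcontM => // eta eta0; exists eta.
Qed.

Definition ball n (rho : K) (c c' : 'I_n -> K) := forall i, vle rho (c' i - c i).

Lemma mpoly_vcont n (p : {mpoly K[n]}) c : vcont (@ball n) (fun d => p.@[d]) c.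
Proof.
have mono a b (y y' : 'I_n -> K) : vle a b -> ball b y y' -> ball a y y'.
  by move=> ab h i; exact: vle_trans (h i).
elim/mpoly_ring_ind: p => [a|i|p q hp hq|p q hp hq].
- by apply: (vcont_ext (f := fun=> a)) (vcont_const _ _ _) => d; rewrite mevalC.
- apply: (vcont_ext (f := fun d => d i)) => [d|eta eta0]; first exact: mevalXU.
  by exists eta.
- by apply: (vcont_ext _ (vcontD mono hp hq)) => d; rewrite mevalD.
- by apply: (vcont_ext _ (vcontM mono hp hq)) => d; rewrite mevalM.
Qed.

End Continuity.

(** * Zariski density of the bad polynomials *)

Section Density.
Variables (K : fieldType) (G : orderedAbelianGroupType) (v : valuation K G).
Hypothesis char0 : [pchar K] =i pred0.
Local Notation vle := (val_le v).
Local Notation vmax := (val_small v).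
Local Notation vint := (val_integral v).
Local Notation vunit := (val_unit v).

Lemma exists_vmax : exists2 y, y != 0 & vmax y.
Proof.
have [g g0] := val_nontriv v; have [x vx] := val_surj v g.
have x0 : x != 0 by apply: contraNneq g0 => x0; move: vx; rewrite x0 val_zero.
case: (boolP (~~ vle x 1)) => [h|/negPn h]; first by exists x.
exists x^-1; rewrite ?invr_eq0 //; apply/(vmax_inv v); rewrite ?invr_eq0 // invrK => hx.
move: hx h; rewrite /val_integral /val_le val_one vx /= => h1 h2.
by move: g0; rewrite eq_le h1 h2.
Qed.

Definition monic_of n (c : 'I_n -> K) : {poly K} := 'X^n + poly_of c.
Definition badc n (c : 'I_n -> K) := bad v n (monic_of c).

Lemma size_monic_of n (c : 'I_n -> K) : size (monic_of c) = n.+1.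
Proof. by rewrite /monic_of size_polyDl size_polyXn // ltnS size_poly_of. Qed.

Lemma monic_of_monic n (c : 'I_n -> K) : monic_of c \is monic.
Proof.
rewrite monicE lead_coefDl ?lead_coefXn // size_polyXn ltnS; exact: size_poly_of.
Qed.

Lemma monic_of_coef n f : f \is monic -> size f = n.+1 -> monic_of (fun i : 'I_n => f`_i) = f.
Proof.
move=> mf sf; apply/polyP => i; rewrite coefD coefXn.
have [->|ni] := eqVneq i n.
  rewrite [(poly_of _)`_n]nth_default ?size_poly_of // addr0.
  by have := monicP mf; rewrite /lead_coef sf.
case: (ltnP i n) => h; first by rewrite add0r (coef_poly_of _ (Ordinal h)).
rewrite !nth_default ?add0r ?(leq_trans (size_poly_of _)) ?sf //.
by rewrite ltn_neqAle eq_sym ni.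
Qed.

Lemma coef_monic_of n (c : 'I_n -> K) (i : 'I_n) : (monic_of c)`_i = c i.
Proof. by rewrite /monic_of coefD coefXn coef_poly_of (ltn_eqF (ltn_ord i)) add0r. Qed.

Lemma monic_ofE n (c : 'I_n -> K) x : (monic_of c).[x] = x ^+ n + \sum_(i < n) c i * x ^+ i.
Proof. by rewrite /monic_of hornerD hornerXn poly_ofE. Qed.

Lemma monic_ofB n (c d : 'I_n -> K) : monic_of d = monic_of c + poly_of (fun i => d i - c i).
Proof.
rewrite /monic_of -addrA; congr (_ + _); rewrite /poly_of -big_split; apply: eq_bigr => i _ /=.
by rewrite -mulrDl -polyCD addrC subrK.
Qed.

(** All conditions in [bad] other than the absence of roots only depend on the coefficients modulo
    M. *)
Lemma bad_near n (c d : 'I_n -> K) : badc c -> (forall i, vmax (d i - c i)) ->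
  (forall x, vmax x -> (monic_of d).[x] != 0) -> badc d.
Proof.
move=> [_ _ vc c0 [c1 _]] near nr; set e := poly_of (fun i => d i - c i).
have ve i : vmax e`_i.
  rewrite /e /poly_of coef_sum; elim/big_ind: _ => [||k _]; [exact: vmax0|exact: vmaxD|].
  by rewrite coefCM coefXn; apply: vmaxMr => //; exact: vint_nat.
have vpe : vpoly v e by move=> i; exact: vmax_vint.
rewrite /badc; split; [exact: monic_of_monic|exact: size_monic_of|..].
- by rewrite (monic_ofB c d); exact: vpolyD.
- rewrite (monic_ofB c d) hornerD; apply: vmaxD => //.
  by rewrite horner_coef0; exact: ve.
- split=> //; rewrite (monic_ofB c d) derivD hornerD; apply: vunitD => //.
  by rewrite horner_coef0 coef_deriv mulr1n; exact: ve.
Qed.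

(** In characteristic 0 the integral multiples rho * i are infinitely many points of the ball; the
    first [size p] of them are too many roots. *)
Lemma poly_eq0_near (p : {poly K}) rho : rho != 0 ->
  (forall s, vle rho s -> p.[s] = 0) -> p = 0.
Proof.
move=> rho0 h; apply: contrapT => /eqP p0.
have := @max_poly_roots K p [seq rho * i%:R | i <- iota 0 (size p)] p0.
rewrite size_map size_iota ltnn => H; suff : false by []; apply: H.
  apply/allP => _ /mapP[i _ ->]; apply/rootP; apply: h; apply: vleMint; last exact: vle_refl.
  exact: vint_nat.
rewrite map_inj_uniq ?iota_uniq // => i j /(mulfI rho0).
wlog ij : i j / (i <= j)%N.
  by move=> W; case: (leqP i j) => [/W //|/ltnW /W + /esym] => H1 /H1.
move/eqP; rewrite eq_sym -subr_eq0 -natrB //; move/pcharf0P: char0 => ->.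
by rewrite subn_eq0 => ji; apply/eqP; rewrite eqn_leq ij.
Qed.

(** The curves of [char_poly_deformation] consist of bad points for all small s, and a polynomial in
    s vanishing at all small s is zero. *)
Lemma bad_dense n (Q : {mpoly K[n]}) :
  (forall m g, (m < n)%N -> ~ bad v m g) -> (exists f, bad v n f) ->
  (forall c, badc c -> Q.@[c] = 0) -> Q = 0.
Proof.
move=> n_min bad_ex; apply: mpoly_eq0_deform => //.
  case: bad_ex => f hf; exists (fun i : 'I_n => f`_i); rewrite /badc monic_of_coef //; by case: hf.
move=> c j hc; have n1 := bad_size hc.
have irr := bad_irreducible n_min hc.
have sf := size_monic_of c; have mf := monic_of_monic c.
case: n n_min c j hc n1 irr sf mf {bad_ex Q} => // m _ c j hc n1 irr sf mf.
have sep : (monic_of c)^`() != 0 by apply: deriv_neq0 => //; rewrite sf.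
have [A hA] := exists_companion mf sf.
have [H [w [H0 H1 Hn]]] := char_poly_deformation mf sf irr sep hA j.
have H0' i : (H i).[0] = c i by rewrite H0 coef_monic_of.
exists H; split=> // p hp.
have [y y0 ym] := exists_vmax.
have [rho rho0 hrho] : exists2 rho, rho != 0 & forall i s, vle rho s -> vmax ((H i).[s] - c i).
  apply: (@vle_bound_fin _ _ v _ (fun i rho => forall s, vle rho s -> vmax ((H i).[s] - c i))).
    by move=> i a b ab h s bs; apply: h; exact: vle_trans bs.
  move=> i; have [rho rho0 h] := poly_vcont v (H i) 0 y0; exists rho => // s hs.
  by apply: (vmax_vle _ ym); rewrite -H0'; apply: h; rewrite subr0.
have [b [b0 bi bw]] := vint_scale v w`_1.
(* Divisibility by rho keeps the coefficients in place modulo M; divisibility by y b puts s w_1 into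
   M, so that 1 + s w_1 is nonzero. *)
have [r [r0 rr rb]] := vle_bound v rho0 (mulf_neq0 y0 b0).
apply: (poly_eq0_near r0) => s hs; apply: hp; apply: (bad_near hc) => [i|x _].
  by apply: hrho; exact: vle_trans hs.
rewrite monic_ofE; apply: Hn => //.
suff : vmax (s * w`_1) by move/vunit1D/vunit_neq0.
apply: (@vmax_vle _ _ v (y * b * w`_1)).
  by apply: vleM2; [exact: vle_trans hs|exact: vle_refl].
by rewrite -mulrA; apply: vmaxMr.
Qed.

End Density.

(** * Henselianity *)

Section Henselianity.
Variables (K : fieldType) (G : orderedAbelianGroupType) (v : valuation K G).
Hypothesis char0 : [pchar K] =i pred0.
Hypothesis qe : admits_QE (Th (mac_structure v)).
Hypothesis hpow : forall n x, val_small v x -> is_power n (1 + n%:R ^+ 2 * x).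
Hypothesis happrox : forall f z, vpoly v f -> val_small v f.[0] -> val_unit v f^`().[0] ->
  z != 0 -> exists x, val_small v x /\ val_le v z f.[x].
Local Notation M := (mac_structure v).
Local Notation vle := (val_le v).
Local Notation vmax := (val_small v).
Local Notation vint := (val_integral v).
Local Notation vunit := (val_unit v).

Definition ev_pt n (c : 'I_n -> K) : {rmorphism {mpoly K[n]} -> K} := meval c.

Lemma ev_ptE n (c : 'I_n -> K) p : ev_pt c p = p.@[c]. Proof. by []. Qed.

Lemma ev_near n (p : {mpoly K[n]}) c delta : p.@[c] != 0 -> delta != 0 ->
  exists2 rho, rho != 0 & forall c', ball v rho c c' ->
    exists2 x, vle delta x & p.@[c'] = p.@[c] * (1 + x).
Proof.
move=> pc d0; have [rho rho0 h] := mpoly_vcont v p c (mulf_neq0 pc d0).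
exists rho => // c' /h hc'; exists ((p.@[c'] - p.@[c]) / p.@[c]).
  by rewrite -(@vleMl _ _ v p.@[c]) // mulrCA mulfV // mulr1.
by field.
Qed.

Lemma is_power_near m : (0 < m)%N -> exists2 d, d != 0 & forall x, vle d x ->
  vunit (1 + x) /\ is_power m (1 + x).
Proof.
move=> m0; have [y y0 ym] := exists_vmax v.
have n2 : m%:R ^+ 2 != 0 :> K.
  by rewrite expf_neq0 //; move/pcharf0P: char0 => ->; rewrite -lt0n.
exists (m%:R ^+ 2 * y); first by rewrite mulf_neq0.
move=> x hx; split.
  by apply: vunit1D; apply: (vmax_vle hx); apply: vmaxMl => //; apply: vintX; exact: vint_nat.
have -> : x = m%:R ^+ 2 * (x / m%:R ^+ 2) by rewrite mulrC divfK.
apply: hpow; apply: (vmax_vle _ ym).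
by rewrite -(@vleMl _ _ v (m%:R ^+ 2)) // mulrCA mulfV // mulr1.
Qed.

Lemma definable_has_root n :
  definable v (fun c : 'I_n -> K => exists x, vmax x /\ (monic_of c).[x] = 0).
Proof.
pose S (E : 'I_n.+1 -> K) := vmax (E ord0) /\
  (E ord0) ^+ n + (poly_of (fun i => E (lift ord0 i))).[E ord0] = 0.
have hS : definable v S.
  apply: definable_and; first by apply: definable_vmax; exact: termfun_var.
  apply: definable_eq; last exact: termfun0.
  apply: termfunD; first by apply: termfunX; exact: termfun_var.
  by apply: termfun_poly_of => [i|]; exact: termfun_var.
apply: (definable_ext _ (definable_ex hS)) => c.
have E x : S (extend x c) <-> vmax x /\ (monic_of c).[x] = 0.
  rewrite /S extend0 /monic_of hornerD hornerXn.
  by have -> // : (fun i => extend x c (lift ord0 i)) = c by apply/funext => i; rewrite extend_lift.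
by split=> -[x hx]; exists x; apply/E.
Qed.

Section Minimal.
Variable n : nat.
Hypothesis n_min : forall m g, (m < n)%N -> ~ bad v m g.
Hypothesis bad_ex : exists f, bad v n f.
Local Open Scope classical_set_scope.
Local Notation J := (('I_n -> K) * K)%type.

(** A pair is a centre and a radius. The bound on the radius may depend on the centre, since the
    neighbourhoods on which a formula is constant shrink towards the hypersurface Q = 0. *)
Definition generic : set_system J := [set A | exists2 Q : {mpoly K[n]}, Q != 0 &
  forall c, badc v c -> Q.@[c] != 0 ->
    exists2 rho0, rho0 != 0 & forall rho, rho != 0 -> vle rho0 rho -> A (c, rho)].

(** Properness is exactly the density of the bad points; intersections correspond to products of the
    equations Q. *)
Lemma generic_filter : ProperFilter generic.
Proof.
split.
  move=> [Q Q0 h]; move/eqP: Q0; apply; apply: (bad_dense char0 n_min bad_ex) => c hc.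
  apply: contrapT => /eqP Qc; have [rho0 r0 /(_ rho0 r0)] := h c hc Qc; apply; exact: vle_refl.
split.
- exists 1; first exact: oner_neq0.
  by move=> c _ _; exists 1; first exact: oner_neq0.
- move=> A C [Q Q0 h] [Q' Q0' h']; exists (Q * Q'); first by rewrite mulf_neq0.
  move=> c hc; rewrite mevalM mulf_eq0 negb_or => /andP[qc qc'].
  have [r r0 hr] := h c hc qc; have [r' r0' hr'] := h' c hc qc'.
  have [s [s0 rs rs']] := vle_bound v r0 r0'; exists s => // rho rho0 srho.
  by split; [apply: hr|apply: hr'] => //; apply: vle_trans srho.
- move=> A C AC [Q Q0 h]; exists Q => // c hc qc; have [r r0 hr] := h c hc qc.
  by exists r => // rho rho0 hrho; apply: AC; exact: hr.
Qed.

Definition nbhd (j : J) : set ('I_n -> K) := [set c' | ball v j.2 j.1 c'].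

Lemma generic_near p delta : p != 0 -> delta != 0 ->
  generic [set j | p.@[j.1] != 0 /\ forall c', nbhd j c' ->
     exists2 x, vle delta x & p.@[c'] = p.@[j.1] * (1 + x)].
Proof.
move=> p0 d0; exists p => // c _ pc; have [rho0 r0 h] := ev_near pc d0.
exists rho0 => // rho _ hr; split=> // c' hc'; apply: h => i; exact: vle_trans hr (hc' i).
Qed.

Lemma minimal_bad_false : False.
Proof.
have FP := generic_filter.
have [U [ultraU FU]] := ultraFilterLemma FP.
have [psi qf hpsi] := qe_definable qe (definable_has_root n).
have FU' : ProperFilter U by exact: ultra_proper.
have UI A C : U A -> U C -> U (A `&` C) by exact: filterI.
have US A C : A `<=` C -> U A -> U C by exact: filterS.
have near p delta p0 d0 : U _ := FU _ (@generic_near p delta p0 d0).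
(* For exponent 1 only the unit statement matters: on such a ball a polynomial nonzero at the centre
   keeps its value. *)
have [d1 d10 hd1] := @is_power_near 1 isT.
have h1 : U [set j | forall c c', nbhd j c -> nbhd j c' ->
    sat (M := M) psi (fun i => ev_pt c 'X_i) -> sat (M := M) psi (fun i => ev_pt c' 'X_i)].
  apply: (@transfer_qf K G v J ('I_n -> K) U nbhd ultraU {mpoly K[n]} (@ev_pt n)) => //.
  - move=> p p0; apply: US (near p d1 p0 d10) => -[c rho] /= [pc h] c' /h[x hx E].
    by rewrite ev_ptE E mulf_neq0 // (vunit_neq0 (proj1 (hd1 x hx))).
  - move=> p q p0 q0; apply: US (UI _ _ (near p d1 p0 d10) (near q d1 q0 d10)).
    move=> [c rho] /= [[pc hp] [qc hq]].
    have E c' : nbhd (c, rho) c' -> vle (ev_pt c' p) (ev_pt c' q) = vle p.@[c] q.@[c].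
      move=> hc'; rewrite !ev_ptE.
      have [x hx ->] := hp c' hc'; have [x' hx' ->] := hq c' hc'.
      by rewrite vle_unitM ?vle_unitMr //; [case: (hd1 x' hx')|case: (hd1 x hx)].
    by move=> b b' hb hb'; rewrite !E.
  - move=> m p q m1 p0 q0; have [d d0 hd] := @is_power_near m (ltnW m1).
    apply: US (UI _ _ (near p d p0 d0) (near q d q0 d0)) => -[c rho] /= [[pc hp] [qc hq]].
    have E c' : nbhd (c, rho) c' -> is_power m (ev_pt c' p / ev_pt c' q) <-> is_power m (p.@[c] / q.@[c]).
      move=> hc'; rewrite !ev_ptE.
      have [x hx ->] := hp c' hc'; have [x' hx' ->] := hq c' hc'.
      have [u1 P1] := hd x hx; have [u2 P2] := hd x' hx'.
      have -> : p.@[c] * (1 + x) / (q.@[c] * (1 + x')) = p.@[c] / q.@[c] * ((1 + x) / (1 + x')).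
        by field; rewrite qc (vunit_neq0 u2).
      apply: is_powerMr; first by rewrite mulf_neq0 ?invr_eq0 ?(vunit_neq0 u1) ?(vunit_neq0 u2).
      by apply: is_powerM => //; exact: is_powerV.
    by move=> b b' hb hb' /(E _ hb)/(E _ hb').
have h2 : U [set j | badc v j.1 /\ j.2 != 0].
  apply: FU; exists 1; first exact: oner_neq0.
  by move=> c hc _; exists 1; [exact: oner_neq0|].
have [[c rho] [/= h [hc rho0]]] := filter_ex (UI _ _ h1 h2).
have n1 := bad_size hc; have n0 : (0 < n)%N by lia.
case: (hc) => mf sf vf f0 [f1 nr].
have [x [hx fx]] := happrox vf f0 f1 rho0.
pose i0 : 'I_n := Ordinal n0.
(* Since rho divides f(x), subtracting f(x) from the constant coefficient does not leave the ball,
   and x becomes a root. *)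
pose c' (i : 'I_n) := if i == i0 then c i - (monic_of c).[x] else c i.
have hb : nbhd (c, rho) c by move=> i /=; rewrite subrr; exact: vle0.
have hb' : nbhd (c, rho) c'.
  move=> i /=; rewrite /c'; case: eqP => _; last by rewrite subrr; exact: vle0.
  by rewrite addrAC subrr add0r vleN.
have evX (d : 'I_n -> K) : (fun i => ('X_i).@[d]) = d.
  by apply/funext => i; rewrite mevalXU.
have : exists x, vmax x /\ (monic_of c).[x] = 0; last first.
  by move=> [y [hy /eqP]]; apply/negP; exact: nr.
apply/(hpsi c); rewrite -(evX c); apply: (h c' c) => //; rewrite (evX c'); apply/(hpsi c').
exists x; split=> //; rewrite (monic_ofB c c') hornerD poly_ofE (bigD1 i0) //= big1.
  by rewrite /c' eqxx expr0 mulr1 addr0 addrAC subrr add0r subrr.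
by move=> i /negPf ii; rewrite /c' ii subrr mul0r.
Qed.

End Minimal.

Lemma no_bad n f : ~ bad v n f.
Proof.
elim/ltn_ind: n f => n IH f hf; apply: (@minimal_bad_false n); last by exists f.
by move=> m g mn; exact: IH.
Qed.

Lemma monic_root (f : {poly K}) : f \is monic -> vpoly v f -> vmax f.[0] -> vunit f^`().[0] ->
  exists2 x, vmax x & f.[x] = 0.
Proof.
move=> mf vf f0 f1; apply: contrapT => nr.
have f_neq0 := monic_neq0 mf.
apply: (@no_bad (size f).-1 f); split=> //; first by rewrite prednK // size_poly_gt0.
by split=> // x hx; apply/eqP => fx; apply: nr; exists x.
Qed.

(* Substituting c0 / Y for X in f = c0 + c1 X + X^2 g turns f into a monic
   polynomial in Y with a simple approximate root at - c1. *)
Lemma simple_root (f : {poly K}) : vpoly v f -> vmax f.[0] -> vunit f^`().[0] ->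
  exists2 x, vmax x & f.[x] = 0.
Proof.
move=> vf f0 f1; have [c00|c00] := eqVneq f.[0] 0.
  by exists 0 => //; exact: vmax0.
pose c0 := f`_0; pose c1 := f`_1; pose g := drop_poly 2 f.
have c0E : f.[0] = c0 by rewrite horner_coef0.
have c1E : f^`().[0] = c1 by rewrite horner_coef0 coef_deriv mulr1n.
rewrite c0E in f0 c00; rewrite c1E in f1.
have fE x : f.[x] = c0 + c1 * x + x ^+ 2 * g.[x].
  rewrite -[in LHS](poly_take_drop 2 f) hornerD hornerM hornerXn mulrC; congr (_ + _).
  rewrite (@horner_coef_wide _ 2) ?size_take_poly // !big_ord_recr big_ord0 /= !coef_take_poly /=.
  by rewrite expr0 expr1 mulr1 add0r.
pose N := size g.
(* This is Y^(N-1) g(c0 / Y). The identity [sE] is multiplied by y so that it also holds for g = 0,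
   where N = 0. *)
pose s : {poly K} := \sum_(i < N) (g`_i * c0 ^+ i)%:P * 'X^(N.-1 - i).
have sE y : y != 0 -> s.[y] * y = y ^+ N * g.[c0 / y].
  move=> y0; rewrite /s horner_sum mulr_suml horner_coef mulr_sumr; apply: eq_bigr => i _.
  rewrite hornerM hornerC hornerXn -mulrA -exprSr exprMn exprVn.
  have -> : y ^+ N = y ^+ (N.-1 - i).+1 * y ^+ i.
    by rewrite -exprD; congr (_ ^+ _); case: i => i /=; lia.
  by field; rewrite expf_neq0.
have vc0 : vint c0 by exact: vmax_vint.
have vs : vpoly v s.
  move=> k; rewrite /s coef_sum; elim/big_ind: _ => [||i _]; [exact: vint0|exact: vintD|].
  rewrite coefCM coefXn; apply: vintM; last exact: vint_nat.
  by apply: vintM; [rewrite /g coef_drop_poly|exact: vintX].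
have ss : (size s <= N)%N.
  apply: (leq_trans (size_sum _ _ _)); apply/bigmax_leqP => i _.
  rewrite mul_polyC (leq_trans (size_scale_leq _ _)) // size_polyXn.
  by case: i => i /=; lia.
(* With Y = X - c1 the approximate root Y = - c1 moves to X = 0, and y^N f(c0 / y) = (c0 / y) h(x)
   for y = x - c1. *)
pose h : {poly K} := ('X - c1%:P) ^+ N * 'X + c0%:P * (s \Po ('X - c1%:P)).
have vL : vpoly v ('X - c1%:P).
  by rewrite -polyCN; apply: vpolyD; [exact: vpolyX|apply: vpolyC; apply: vintN; case: f1].
have vLX k : vpoly v (('X - c1%:P) ^+ k).
  elim: k => [|k IH]; first by rewrite expr0 -[1]/(1%:P); apply: vpolyC; exact: vint1.
  by rewrite exprS; exact: vpolyM.
have vsc : vpoly v (s \Po ('X - c1%:P)) by exact: vpoly_comp.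
have vh : vpoly v h.
  by apply: vpolyD; apply: vpolyM => //; [exact: vpolyX|exact: vpolyC].
have mh : h \is monic.
  have mX : ('X - c1%:P) ^+ N * 'X \is monic by rewrite monicMl ?monicX // monic_exp ?monicXsubC.
  rewrite monicE lead_coefDl; first by rewrite (monicP mX).
  rewrite size_mulX ?expf_neq0 ?polyXsubC_eq0 // size_exp_XsubC.
  rewrite mul_polyC (leq_ltn_trans (size_scale_leq _ _)) //.
  by rewrite size_comp_poly2 ?size_XsubC // ltnS (leq_trans ss).
have hE x : h.[x] = (x - c1) ^+ N * x + c0 * s.[x - c1].
  by rewrite /h !(hornerD, hornerM, horner_exp, hornerX, hornerC, hornerN, horner_comp).
have [||x hx hx0] := monic_root mh vh.
- rewrite hE mulr0 add0r; apply: vmaxMr => //; apply: vpoly_horner => //.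
  by rewrite sub0r; apply: vintN; case: f1.
- rewrite /h derivD !derivM derivX derivC mul0r add0r mulr1 !hornerD !hornerM hornerX hornerC mulr0 add0r.
  rewrite horner_exp !(hornerD, hornerN, hornerX, hornerC) sub0r.
  apply: vunitD; first by apply: vunitX; exact: vunitN.
  apply: vmaxMr => //; apply: vpoly_horner; [exact: vpoly_deriv|exact: vint0].
pose y := x - c1.
have uy : vunit y by rewrite /y addrC; apply: vunitD => //; exact: vunitN.
have y0 := vunit_neq0 uy.
exists (c0 / y); first by apply: vmaxMr => //; case: (vunitV uy).
have Y0 : y ^+ N != 0 by exact: expf_neq0.
apply: (mulfI Y0); rewrite mulr0 fE mulrDr.
have -> : y ^+ N * ((c0 / y) ^+ 2 * g.[c0 / y]) = (c0 / y) ^+ 2 * (s.[y] * y).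
  by rewrite sE // mulrCA.
have -> : y ^+ N * (c0 + c1 * (c0 / y)) + (c0 / y) ^+ 2 * (s.[y] * y) =
    c0 / y * (y ^+ N * x + c0 * s.[y]).
  have -> : x = y + c1 by rewrite /y subrK.
  by field.
by rewrite -hE hx0 mulr0.
Qed.

Lemma nonunits_val_ring x : nonunits (val_ring v) x <-> vmax x.
Proof.
split=> [[/vint_ring hx [->|h]]|h]; first exact: vmax0.
  have [->|x0] := eqVneq x 0; first exact: vmax0.
  by apply/vmax_inv => // /vint_ring.
split; first by apply/vint_ring; exact: vmax_vint.
have [->|x0] := eqVneq x 0; [by left|right=> /vint_ring].
exact/vmax_inv.
Qed.

Lemma henselian_of_approx : henselian v.
Proof.
split.
  split.
  - split; first by apply/mem_set/vint_ring; exact: vint1.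
      move=> x y /set_mem/vint_ring hx /set_mem/vint_ring hy; apply/mem_set/vint_ring; exact: vintB.
    move=> x y /set_mem/vint_ring hx /set_mem/vint_ring hy; apply/mem_set/vint_ring; exact: vintM.
  - split=> // h; have [y y0 ym] := exists_vmax v.
    by move/(vmax_inv v y0): ym; apply; apply/vint_ring; exact: h.
  - move=> x _ x0; case/orP: (vle_total v 1 x) => h; first by left; apply/vint_ring.
    by right; apply/vint_ring; rewrite /val_integral -invr1 vleV ?oner_neq0.
move=> f a /vpolyOver vf /vint_ring va /nonunits_val_ring h0 h1.
have vXa : vpoly v ('X + a%:P) by apply: vpolyD; [exact: vpolyX|exact: vpolyC].
have [|||x hx fx] := @simple_root (f \Po ('X + a%:P)).
- exact: vpoly_comp.
- by rewrite horner_comp hornerD hornerX hornerC add0r.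
- rewrite deriv_comp derivD derivX derivC addr0 mulr1 horner_comp hornerD hornerX hornerC add0r.
  split; first by apply: vpoly_horner => //; exact: vpoly_deriv.
  by move/nonunits_val_ring.
exists (x + a); split.
- by apply/vint_ring; apply: vintD => //; exact: vmax_vint.
- by apply/rootP; move: fx; rewrite horner_comp hornerD hornerX hornerC.
- by apply/nonunits_val_ring; rewrite addrK.
Qed.

End Henselianity.

(** * Approximate roots in the two residue characteristics *)

Section ApproxCases.
Variables (K : fieldType) (G : orderedAbelianGroupType) (v : valuation K G).
Hypothesis char0 : [pchar K] =i pred0.
Hypothesis qe : admits_QE (Th (mac_structure v)).
Hypothesis hpow : forall n x, val_small v x -> is_power n (1 + n%:R ^+ 2 * x).
Implicit Types (f : {poly K}) (z : K).

Lemma approx_poly y z f : approx_roots v y z (size f) -> vpoly v f ->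
  val_le v y f.[0] -> val_unit v f^`().[0] -> exists x, val_small v x /\ val_le v z f.[x].
Proof.
move=> /(_ (fun i => f`_i)); rewrite poly_of_coef // => H vf yf [_ f1].
exact: H (fun i => vf i) yf f1.
Qed.

Lemma approx_residue0 f z : residue_pchar0 v ->
  vpoly v f -> val_small v f.[0] -> val_unit v f^`().[0] -> z != 0 ->
  exists x, val_small v x /\ val_le v z f.[x].
Proof.
move=> rchar0 vf f0 f1 z0; have [e|y0] := eqVneq f.[0] 0.
  by exists 0; rewrite e; split; [exact: vmax0|exact: vle0].
set y := f.[0] in f0 y0.
pose iota : {rmorphism {poly int} -> K} := horner_eval y \o map_poly intr.
have iX : iota 'X = y by rewrite /iota /= map_polyX /horner_eval hornerX.
have iE h : iota h = hornerz y h by [].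
have := @qe_approx_roots K G v char0 qe hpow _ iota 'X z (size f); rewrite iX => H.
apply: (@approx_poly y) => //; last exact: vle_refl.
apply: H => // [h|h h0]; first by rewrite iE; apply: vint_hornerz; exact: vmax_vint.
have [i [m [g [m0 ->]]]] := poly_factorX h0; exists i.
rewrite iE hornerzM hornerzD hornerzM hornerzC hornerzX.
have -> : hornerz y 'X^i = y ^+ i by rewrite /hornerz map_polyXn hornerXn.
rewrite vle_unitM; first exact: vle_refl.
apply: vunitD; first exact: vunit_int0.
by apply: vmaxMr => //; apply: vint_hornerz; exact: vmax_vint.
Qed.

(** In Z[f(0)] the lowest term need not dominate when p divides its coefficient, so y = p and [R0]
    is Z. The required v(f(0)) >= v(p) is arranged by finitely many Newton steps and a translation,
    because p divides a power of f(0). *)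
Lemma approx_residuep p f z : residue_pchar v p -> tight v p ->
  vpoly v f -> val_small v f.[0] -> val_unit v f^`().[0] -> z != 0 ->
  exists x, val_small v x /\ val_le v z f.[x].
Proof.
move=> rp tp vf f0 f1 z0; have [e|y0] := eqVneq f.[0] 0.
  by exists 0; rewrite e; split; [exact: vmax0|exact: vle0].
have [pp pm] := rp.
have [N hN] := tight_archi tp f0 y0.
have [x0 x0m hx0] := newton N vf f1 f0 (vle_refl v _).
have px0 : val_le v p%:R f.[x0].
  by apply: vle_trans hN _; apply: vle_trans hx0; apply: vle_expl => //; exact: vmax_vint.
pose g := f \Po ('X + x0%:P).
have gE x : g.[x] = f.[x + x0] by rewrite horner_comp hornerD hornerX hornerC.
have vg : vpoly v g.
  by apply: vpoly_comp => //; apply: vpolyD; [exact: vpolyX|apply: vpolyC; exact: vmax_vint].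
have [x [hx hz]] : exists x, val_small v x /\ val_le v z g.[x]; last first.
  by exists (x + x0); rewrite -gE; split=> //; exact: vmaxD.
have := @qe_approx_roots K G v char0 qe hpow _ (intmul 1 : {rmorphism int -> K}) p z (size g).
rewrite /= -pmulrn => H; apply: (approx_poly (H _ _ _ _ _)) => //.
- by apply/vmax_ideal.
- by move/pcharf0P: char0 => ->; rewrite -lt0n prime_gt0.
- exact: vint_int.
- by move=> m; exact: (vle_int_expp rp).
- by rewrite gE add0r.
- rewrite /g deriv_comp derivD derivX derivC addr0 mulr1 horner_comp hornerD hornerX hornerC add0r.
  by apply: vunit_horner => //; exact: vpoly_deriv.
Qed.

End ApproxCases.

Theorem theorem3p21 (K : fieldType) (G : orderedAbelianGroupType)
    (v : valuation K G)
    (char0 : [pchar K] =i pred0)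
    (qe : admits_QE (Th (mac_structure v)))
    (hyp_i : residue_pchar0 v -> prohenselian v 2)
    (hyp_ii : forall p : nat, residue_pchar v p ->
       [/\ prohenselian v 1, tight v p & exists C, conservative v p C]) :
  henselian v.
Proof.
have [rchar0|/existsNP[p /contrapT rp]] := pselect (residue_pchar0 v).
  have H1 : prohenselian v 1.
    move=> m t /andP[m0 m1]; apply: (hyp_i rchar0); rewrite m0 /=; exact: leq_trans m1 _.
  have hpow n x : val_small v x -> is_power n (1 + n%:R ^+ 2 * x).
    exact: pow_residue0.
  apply: (henselian_of_approx char0 qe hpow) => f z; exact: approx_residue0.
have [H1 tp _] := hyp_ii p rp.
have hpow n x : val_small v x -> is_power n (1 + n%:R ^+ 2 * x).
  exact: (pow_residuep char0 rp tp H1).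
by apply: (henselian_of_approx char0 qe hpow) => f z; exact: (approx_residuep char0 qe hpow rp tp).
Qed.
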